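(* Let $X:\Sigma^2\rightarrow\mathbb{R}^4$ be an oriented 2-dimensional translating soliton, i.e. an isometric immersion of an oriented Riemannian surface whose mean curvature vector satisfies $H=-V_0^N$ for a fixed unit vector $V_0\in\mathbb{R}^4$. Then the complex phase map $J:\Sigma\rightarrow\mathbb{S}^2$ satisfies $$\tau(J)=dJ\left(V_0^{T}\right),$$ where $\tau(J)$ is the tension field of the map $J$ from $\Sigma$ (with its induced metric) to the round unit sphere $\mathbb{S}^2$.
   Context: Let $\Sigma$ be an oriented surface isometrically immersed in $\mathbb{R}^4$. $(\cdot)^T$ and $(\cdot)^N$ denote orthogonal projections onto the tangent bundle $T\Sigma$ and the normal bundle $T^\perp\Sigma$. The second fundamental form is $B(U,W)=(\overline\nabla_U W)^N$, with $\overline\nabla$ the flat connection of $\mathbb{R}^4$, and the mean curvature vector is $H=\sum_{i=1}^2 B(e_i,e_i)$ for a local orthonormal frame $\{e_1,e_2\}$ of $\Sigma$. Hyperkähler structure: $\mathbb{R}^4$ is equipped with its flat metric and constant (parallel) orthogonal almost complex structures $J_1,J_2,J_3=J_1J_2$ satisfying $J_1^2=J_2^2=J_3^2=J_1J_2J_3=-1$. Complex phase map: an oriented immersed surface $\Sigma\subset\mathbb{R}^4$ is always hyper-Lagrangian, meaning that for each $x\in\Sigma$ there is a unit vector $(\lambda_1,\lambda_2,\lambda_3)\in\mathbb{S}^2\subset\mathbb{R}^3$ such that $\langle K\cdot,\cdot\rangle|_{T_x\Sigma}=0$ for every $K=\sum_\alpha\mu_\alpha J_\alpha$ with $\sum_\alpha\lambda_\alpha\mu_\alpha=0$.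 Equivalently, $\sum_\alpha\lambda_\alpha J_\alpha$ preserves $T_x\Sigma$. The vector is determined up to sign, and the sign is fixed by the orientation: $\sum_\alpha\lambda_\alpha J_\alpha e_1=e_2$ for an oriented orthonormal basis $\{e_1,e_2\}$ of $T_x\Sigma$, i.e. $\lambda_\alpha=\langle J_\alpha e_1,e_2\rangle$. The complex phase map is $J:\Sigma\to\mathbb{S}^2$, $J(x)=(\lambda_1,\lambda_2,\lambda_3)$. *)

(* Defs.v *)
(* Vectors are row vectors, so the Jacobian 'J f x has the
   partial derivatives of f as its rows and maps v to v *m 'J f x. *)
From mathcomp Require Import all_boot all_order all_algebra.
From mathcomp Require Import all_classical all_reals all_analysis.

Set Implicit Arguments.
Unset Strict Implicit.
Unset Printing Implicit Defensive.

Import Order.TTheory GRing.Theory Num.Theory.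
Import numFieldNormedType.Exports.

Local Open Scope classical_set_scope.
Local Open Scope ring_scope.

Definition dot (R : realType) (n : nat) (u v : 'rV[R]_n) : R := (u *m v^T) 0 0.

(* For D open: f is C^(k+1) on D iff it is differentiable on D and all its
   directional derivatives are C^k on D. *)
Fixpoint Ck_on (R : realType) (V W : normedModType R) (k : nat)
    (D : set V) (f : V -> W) : Prop :=
  if k is k'.+1 then
    (forall x, D x -> differentiable f x) /\ (forall v, Ck_on k' D ('D_v f))
  else forall x, D x -> {for x, continuous f}.

Definition smooth_on (R : realType) (V W : normedModType R)
    (D : set V) (f : V -> W) : Prop := forall k, Ck_on k D f.

Record chart (R : realType) (T : topologicalType) := Chart {
  chart_dom : set T;
  chart_img : set 'rV[R]_2;
  coord : T -> 'rV[R]_2;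
  param : 'rV[R]_2 -> T;
  chart_dom_open : open chart_dom;
  chart_img_open : open chart_img;
  coord_img : forall p, chart_dom p -> chart_img (coord p);
  param_dom : forall x, chart_img x -> chart_dom (param x);
  coordK : forall p, chart_dom p -> param (coord p) = p;
  paramK : forall x, chart_img x -> coord (param x) = x;
  coord_continuous : forall p, chart_dom p -> {for p, continuous coord};
  param_continuous : forall x, chart_img x -> {for x, continuous param} }.

Definition overlap (R : realType) (T : topologicalType) (c d : chart R T) :
  set 'rV[R]_2 := chart_img c `&` param c @^-1` chart_dom d.

Definition transition (R : realType) (T : topologicalType) (c d : chart R T) :
  'rV[R]_2 -> 'rV[R]_2 := coord d \o param c.

Record oriented_surface (R : realType) := OrientedSurface {
  surf_points :> topologicalType;
  surf_hausdorff : hausdorff_space surf_points;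
  surf_second_countable : @second_countable surf_points;
  atlas : set (chart R surf_points);
  atlas_cover : forall p, exists2 c, atlas c & chart_dom c p;
  atlas_smooth : forall c d, atlas c -> atlas d ->
    smooth_on (overlap c d) (transition c d);
  atlas_oriented : forall c d, atlas c -> atlas d ->
    forall x, overlap c d x -> 0 < \det ('J (transition c d) x) }.

(* [metric g c x] is the Gram matrix of the coordinate fields of the chart [c]
   at the point of coordinates [x]. *)
Record riemannian_metric (R : realType) (S : oriented_surface R) :=
  RiemannianMetric {
  metric :> chart R S -> 'rV[R]_2 -> 'M[R]_2;
  metric_smooth : forall c, atlas c -> smooth_on (chart_img c) (metric c);
  metric_sym : forall c, atlas c -> forall x, chart_img c x ->
    (metric c x)^T = metric c x;
  metric_pos : forall c, atlas c -> forall x, chart_img c x ->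
    forall u : 'rV[R]_2, u != 0 -> 0 < (u *m metric c x *m u^T) 0 0;
  metric_transition : forall c d, atlas c -> atlas d ->
    forall x, overlap c d x ->
    metric c x = 'J (transition c d) x *m metric d (transition c d x)
                   *m ('J (transition c d) x)^T }.

(* A tangent vector at [param c x] is represented by its components
   [u : 'rV[R]_2] in the chart [c]; the differential of [F] maps it to
   ['D_u (F \o param c) x]. *)
Definition inner (R : realType) (S : oriented_surface R)
    (g : riemannian_metric S) (c : chart R S) (x u v : 'rV[R]_2) : R :=
  (u *m g c x *m v^T) 0 0.

(* Injectivity of the differential follows from [metric_pos]. *)
Definition isometric_immersion (R : realType) (S : oriented_surface R)
    (g : riemannian_metric S) (X : S -> 'rV[R]_4) : Prop :=
  forall c, atlas c ->
    smooth_on (chart_img c) (X \o param c) /\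
    forall x, chart_img c x -> forall u v : 'rV[R]_2,
      dot ('D_u (X \o param c) x) ('D_v (X \o param c) x) = inner g c x u v.

(* Orthogonal projections of R^n onto the row space of A (spanned by the
   partial derivatives when A is a Jacobian) and onto its orthogonal
   complement, [kermx A^T] being the space of all w with w *m A^T = 0. *)
Definition tangent_part (R : realType) (m n : nat) (A : 'M[R]_(m, n))
    (w : 'rV[R]_n) : 'rV[R]_n := w *m proj_mx <<A>>%MS (kermx A^T).

Definition normal_part (R : realType) (m n : nat) (A : 'M[R]_(m, n))
    (w : 'rV[R]_n) : 'rV[R]_n := w *m proj_mx (kermx A^T) <<A>>%MS.

(* For tangent vector fields U and W given by their components in the
   chart [c]. *)
Definition second_fundamental_form (R : realType) (S : oriented_surface R)
    (X : S -> 'rV[R]_4) (c : chart R S) (U W : 'rV[R]_2 -> 'rV[R]_2)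
    (x : 'rV[R]_2) : 'rV[R]_4 :=
  normal_part ('J (X \o param c) x)
    ('D_(U x) (fun y => 'D_(W y) (X \o param c) y) x).

Definition local_orthonormal_frame (R : realType) (S : oriented_surface R)
    (g : riemannian_metric S) (c : chart R S) (x : 'rV[R]_2)
    (e : 'I_2 -> 'rV[R]_2 -> 'rV[R]_2) : Prop :=
  exists D : set 'rV[R]_2,
    [/\ open D, D x, D `<=` chart_img c,
        forall i, smooth_on D (e i) &
        forall y, D y -> forall i j, inner g c y (e i y) (e j y) = (i == j)%:R].

(* B being tensorial, the sum is the same for every frame. *)
Definition is_mean_curvature (R : realType) (S : oriented_surface R)
    (g : riemannian_metric S) (X : S -> 'rV[R]_4) (c : chart R S)
    (x : 'rV[R]_2) (H : 'rV[R]_4) : Prop :=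
  exists e, local_orthonormal_frame g c x e /\
    H = \sum_(i < 2) second_fundamental_form X c (e i) (e i) x.

Definition translating_soliton (R : realType) (S : oriented_surface R)
    (g : riemannian_metric S) (X : S -> 'rV[R]_4) (V0 : 'rV[R]_4) : Prop :=
  isometric_immersion g X /\
  forall c, atlas c -> forall x, chart_img c x ->
    is_mean_curvature g X c x (- normal_part ('J (X \o param c) x) V0).

(* Indices 0, 1, 2 stand for J_1, J_2, J_3. *)
Record hyperkahler (R : realType) := Hyperkahler {
  cplx :> 'I_3 -> {linear 'rV[R]_4 -> 'rV[R]_4};
  cplx_orthogonal : forall a u v, dot (cplx a u) (cplx a v) = dot u v;
  cplx_sqr : forall a u, cplx a (cplx a u) = - u;
  cplx_prod : forall u, cplx 2%R u = cplx 0 (cplx 1 u);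
  cplx_triple : forall u, cplx 0 (cplx 1 (cplx 2%R u)) = - u }.

Definition cplx_comb (R : realType) (J : hyperkahler R) (mu : 'rV[R]_3)
    (u : 'rV[R]_4) : 'rV[R]_4 := \sum_(a < 3) mu 0 a *: J a u.

Definition oriented_orthonormal (R : realType) (S : oriented_surface R)
    (g : riemannian_metric S) (c : chart R S) (x u v : 'rV[R]_2) : Prop :=
  [/\ inner g c x u u = 1, inner g c x v v = 1, inner g c x u v = 0 &
      0 < \det (col_mx u v : 'M[R]_2)].

(* The conditions say that lambda lies on the unit sphere, that the surface is
   hyper-Lagrangian with respect to lambda, and that the sign of lambda is the
   one given by the orientation; [dX u] ranges over the tangent plane. *)
Definition is_complex_phase_map (R : realType) (J : hyperkahler R)
    (S : oriented_surface R) (g : riemannian_metric S) (X : S -> 'rV[R]_4)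
    (phi : S -> 'rV[R]_3) : Prop :=
  forall c, atlas c -> forall x, chart_img c x ->
  let dX u := 'D_u (X \o param c) x in
  let lambda := phi (param c x) in
  [/\ dot lambda lambda = 1,
      forall mu, dot lambda mu = 0 ->
        forall u v, dot (cplx_comb J mu (dX u)) (dX v) = 0 &
      forall u v, oriented_orthonormal g c x u v ->
        cplx_comb J lambda (dX u) = dX v].

(* [christoffel g c x i j k] is Gamma_ij^k. *)
Definition christoffel (R : realType) (S : oriented_surface R)
    (g : riemannian_metric S) (c : chart R S) (x : 'rV[R]_2)
    (i j k : 'I_2) : R :=
  2^-1 * \sum_(l < 2) invmx (g c x) k l *
    ('D_(delta_mx 0 i) (fun y => g c y j l) x +
     'D_(delta_mx 0 j) (fun y => g c y i l) x -
     'D_(delta_mx 0 l) (fun y => g c y i j) x).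

(* Orthogonal projection onto the tangent space of the unit sphere at q; it
   turns the flat connection into the Levi-Civita connection of the sphere. *)
Definition sphere_tangent_part (R : realType) (n : nat) (q w : 'rV[R]_n) :
  'rV[R]_n := w - dot w q *: q.

(* (nabla df)(d_i, d_j) = nabla_{d_i} (df d_j) - df (nabla_{d_i} d_j), for a
   map f into the unit sphere. *)
Definition hess (R : realType) (S : oriented_surface R)
    (g : riemannian_metric S) (n : nat) (f : S -> 'rV[R]_n) (c : chart R S)
    (x : 'rV[R]_2) (i j : 'I_2) : 'rV[R]_n :=
  sphere_tangent_part (f (param c x))
    ('D_(delta_mx 0 i) ('D_(delta_mx 0 j) (f \o param c)) x)
  - \sum_(k < 2) christoffel g c x i j k *: 'D_(delta_mx 0 k) (f \o param c) x.

Definition tension (R : realType) (S : oriented_surface R)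
    (g : riemannian_metric S) (n : nat) (f : S -> 'rV[R]_n) (c : chart R S)
    (x : 'rV[R]_2) : 'rV[R]_n :=
  \sum_(i < 2) \sum_(j < 2) invmx (g c x) i j *: hess g f c x i j.

(* Components in the chart [c] of the tangent vector that dX maps to w^T. *)
Definition tangent_components (R : realType) (S : oriented_surface R)
    (X : S -> 'rV[R]_4) (c : chart R S) (x : 'rV[R]_2) (w : 'rV[R]_4) :
  'rV[R]_2 :=
  tangent_part ('J (X \o param c) x) w *m pinvmx ('J (X \o param c) x).

(* Main.v *)
(* In a chart let p, q be the partial derivatives of the immersion F.  By
   orthonormality the phase map is s (<J_a p, q>)_a with s = (det g)^(-1/2).  The
   soliton equation says that g^ij F_ij + V_0 is tangent, and its tangential
   components are V_0^T + g^ij Gamma_ij, the coefficients of the first-order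
   terms of tau(J) - dJ(V_0^T).  Both sides of the claim are orthogonal to J(x),
   so let mu be their difference and K = sum_a mu_a J_a, for which <K p, q> = 0
   at x.  Differentiating the soliton equation along the surface and pairing
   with K q and K p, which are normal at x, leaves an identity between the first
   and second derivatives of F alone; expanding the second derivatives in the
   basis p, q, K p, K q turns it into a rational identity. *)
Require Import Defs.
From mathcomp Require Import all_boot all_order all_algebra.
From mathcomp Require Import all_classical all_reals all_analysis.
From mathcomp Require Import ring lra.

Set Implicit Arguments.
Unset Strict Implicit.
Unset Printing Implicit Defensive.

Import Order.TTheory GRing.Theory Num.Theory.
Import numFieldNormedType.Exports.
Local Open Scope classical_set_scope.
Local Open Scope ring_scope.

(** * Small sums and the Euclidean inner product *)

Lemma sum2E (V : zmodType) (f : 'I_2 -> V) : \sum_(i < 2) f i = f 0 + f 1.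
Proof.
by rewrite big_ord_recr big_ord_recr big_ord0 /= add0r; congr (f _ + f _); exact: val_inj.
Qed.

Lemma sum3E (V : zmodType) (f : 'I_3 -> V) :
  \sum_(i < 3) f i = f 0 + f 1 + f 2%R.
Proof.
rewrite !big_ord_recr big_ord0 /= add0r.
by congr (f _ + f _ + f _); exact: val_inj.
Qed.

Lemma ord3_cases (P : 'I_3 -> Prop) : P 0 -> P 1 -> P 2%R -> forall i, P i.
Proof.
by move=> P0 P1 P2 [[|[|[|//]]] i3]; [move: P0|move: P1|move: P2];
  congr P; exact: val_inj.
Qed.

Lemma dotE (R : realType) n (u v : 'rV[R]_n) :
  dot u v = \sum_i u 0 i * v 0 i.
Proof. by rewrite /dot mxE; apply: eq_bigr => i _; rewrite mxE. Qed.

Lemma dotC (R : realType) n (u v : 'rV[R]_n) : dot u v = dot v u.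
Proof. by rewrite !dotE; apply: eq_bigr => i _; rewrite mulrC. Qed.

Lemma dotDl (R : realType) n (u v w : 'rV[R]_n) :
  dot (u + v) w = dot u w + dot v w.
Proof. by rewrite /dot mulmxDl mxE. Qed.

Lemma dotZl (R : realType) n a (u w : 'rV[R]_n) : dot (a *: u) w = a * dot u w.
Proof. by rewrite /dot -scalemxAl mxE. Qed.

Lemma dotNl (R : realType) n (u w : 'rV[R]_n) : dot (- u) w = - dot u w.
Proof. by rewrite -scaleN1r dotZl mulN1r. Qed.

Lemma dot0l (R : realType) n (w : 'rV[R]_n) : dot 0 w = 0.
Proof. by rewrite /dot mul0mx mxE. Qed.

Lemma dotDr (R : realType) n (u v w : 'rV[R]_n) :
  dot w (u + v) = dot w u + dot w v.
Proof. by rewrite !(dotC w) dotDl. Qed.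

Lemma dotZr (R : realType) n a (u w : 'rV[R]_n) : dot w (a *: u) = a * dot w u.
Proof. by rewrite !(dotC w) dotZl. Qed.

Lemma dotNr (R : realType) n (u w : 'rV[R]_n) : dot w (- u) = - dot w u.
Proof. by rewrite !(dotC w) dotNl. Qed.

Lemma dot0r (R : realType) n (w : 'rV[R]_n) : dot w 0 = 0.
Proof. by rewrite dotC dot0l. Qed.

Definition dotL := (dotDl, dotDr, dotZl, dotZr, dotNl, dotNr).

Lemma dot_suml (R : realType) n (I : finType) (f : I -> 'rV[R]_n) w :
  dot (\sum_i f i) w = \sum_i dot (f i) w.
Proof.
exact: (big_morph (fun u : 'rV[R]_n => dot u w) (fun x y => dotDl x y w) (dot0l w)).
Qed.

Lemma dot_ge0 (R : realType) n (u : 'rV[R]_n) : 0 <= dot u u.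
Proof. by rewrite dotE; apply: sumr_ge0 => i _; rewrite -expr2 sqr_ge0. Qed.

Lemma dot_eq0 (R : realType) n (u : 'rV[R]_n) : (dot u u == 0) = (u == 0).
Proof.
apply/eqP/eqP => [|->]; last exact: dot0l.
rewrite dotE => /eqP; rewrite psumr_eq0 => [/allP u0|i _]; last by rewrite -expr2 sqr_ge0.
apply/rowP => i; rewrite mxE; have := u0 i (mem_index_enum _).
by rewrite -expr2 sqrf_eq0 => /eqP.
Qed.

(** * Algebra of the three complex structures *)

Lemma cplx_antisym (R : realType) (J : hyperkahler R) a u v :
  dot (J a u) v = - dot u (J a v).
Proof. by rewrite -(cplx_orthogonal J a u) cplx_sqr dotNr opprK. Qed.

(** Squaring [J_3 = J_1 J_2] gives [J_1 J_2 J_1 = J_2], and applying [J_1] yields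
    [J_2 J_1 = - J_1 J_2]; the other two pairs follow by substituting [J_3 = J_1 J_2]. *)
Lemma cplx_anticomm (R : realType) (J : hyperkahler R) a b u : a != b ->
  J a (J b u) = - J b (J a u).
Proof.
have h01 w : J 1 (J 0 w) = - J 0 (J 1 w).
  have e : J 0 (J 1 (J 0 w)) = J 1 w.
    by have := cplx_sqr J 2%R (J 1 w); rewrite !cplx_prod cplx_sqr !linearN => /oppr_inj.
  by rewrite -[LHS]opprK -(cplx_sqr J 0) !linearN /= e.
have h02 w : J 2%R (J 0 w) = - J 0 (J 2%R w).
  by rewrite !cplx_prod h01 linearN.
have h12 w : J 2%R (J 1 w) = - J 1 (J 2%R w).
  by rewrite !cplx_prod cplx_sqr h01 cplx_sqr linearN opprK.
move: a b; apply: ord3_cases; apply: ord3_cases => // _;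
by rewrite ?h01 ?h02 ?h12 ?opprK.
Qed.

(** The mixed terms cancel in pairs by anticommutation, so [cplx_comb J mu] is an isometry scaled by
    the length of [mu]. *)
Lemma cplx_comb_dot (R : realType) (J : hyperkahler R) mu u v :
  dot (cplx_comb J mu u) (cplx_comb J mu v) = dot mu mu * dot u v.
Proof.
have cross a b : a != b -> dot (J a u) (J b v) + dot (J b u) (J a v) = 0.
  by move=> ab; rewrite !cplx_antisym (@cplx_anticomm _ J a b)// dotNr opprK subrr.
have := (cross 0 1 isT, cross 0 2%R isT, cross 1 2%R isT).
rewrite /cplx_comb !sum3E !dotL !cplx_orthogonal (dotE mu) sum3E => -[[h1 h2] h3].
nra.
Qed.

Lemma cplx_comb_antisym (R : realType) (J : hyperkahler R) mu u v :
  dot (cplx_comb J mu u) v = - dot u (cplx_comb J mu v).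
Proof. by rewrite /cplx_comb !sum3E !dotL !cplx_antisym; ring. Qed.

(** Antisymmetry of [K] and [<K p, q> = 0] make the span of [p, q] orthogonal to that of [K p, K q].
    Since [K] is a scaled isometry, neither pair has a vanishing Gram determinant, so the four
    vectors are independent in dimension 4. *)
Lemma adapted_basis (R : realType) (J : hyperkahler R) mu (p q : 'rV[R]_4) :
  let K := cplx_comb J mu in
  mu != 0 -> dot (K p) q = 0 ->
  dot p p * dot q q - dot p q ^+ 2 != 0 ->
  forall w, exists a b c d, w = a *: p + b *: q + c *: K p + d *: K q.
Proof.
move=> K mu0 Kpq D0 w.
have m0 : dot mu mu != 0 by rewrite dot_eq0.
have Kpp u : dot (K u) u = 0.
  have := cplx_comb_antisym J mu u u; rewrite (dotC u) -/K => h; lra.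
have Kqp : dot (K q) p = 0 by rewrite cplx_comb_antisym dotC Kpq oppr0.
pose M : 'M[R]_4 := \matrix_(i < 4) [:: p; q; K p; K q]`_i.
have ME v : v *m M = v 0 0 *: p + v 0 1 *: q + v 0 2%R *: K p + v 0 3%R *: K q.
  rewrite mulmx_sum_row !big_ord_recr big_ord0 /= add0r !rowK /=.
  by congr (_ *: _ + _ *: _ + _ *: _ + _ *: _); congr (v 0 _); exact: val_inj.
(* Cramer's rule for a homogeneous symmetric system; it serves the pair [p, q] and then the pair
   [K p, K q]. *)
have solve2 (a b e f g : R) : e * g - f ^+ 2 != 0 ->
    a * e + b * f = 0 -> a * f + b * g = 0 -> a = 0 /\ b = 0.
  move=> d0 h1 h2; split; apply: (mulIf d0); rewrite mul0r.
    have -> : a * (e * g - f ^+ 2) = (a * e + b * f) * g - (a * f + b * g) * f by ring.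
    by rewrite h1 h2; ring.
  have -> : b * (e * g - f ^+ 2) = (a * f + b * g) * e - (a * e + b * f) * f by ring.
  by rewrite h1 h2; ring.
have /eqP Mfull : row_free M.
  apply/inj_row_free => v; rewrite ME => v0.
  have dv u : dot (v 0 0 *: p + v 0 1 *: q + v 0 2%R *: K p + v 0 3%R *: K q) u = 0.
    by rewrite v0 dot0l.
  have [] := solve2 (v 0 0) (v 0 1) _ _ _ D0.
  - by have := dv p; rewrite !dotL Kpp Kqp (dotC q p) => <-; ring.
  - by have := dv q; rewrite !dotL Kpp Kpq => <-; ring.
  move=> v00 v01.
  have [] := solve2 (v 0 2%R) (v 0 3%R) _ _ _ D0.
  - apply: (mulfI m0); rewrite mulr0.
    have := dv (K p); rewrite !dotL !cplx_comb_dot v00 v01 (dotC q p) => <-; ring.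
  - apply: (mulfI m0); rewrite mulr0.
    have := dv (K q); rewrite !dotL !cplx_comb_dot v00 v01 => <-; ring.
  move=> v02 v03; apply/rowP => i; rewrite [RHS]mxE.
  case: i => [[|[|[|[|//]]]] i4]; [rewrite -[RHS]v00|rewrite -[RHS]v01|
    rewrite -[RHS]v02|rewrite -[RHS]v03]; congr (v 0 _); exact: val_inj.
have /submxP[v ->] : (w <= M)%MS by apply: submx_full; rewrite /row_full Mfull.
by exists (v 0 0), (v 0 1), (v 0 2%R), (v 0 3%R).
Qed.

(* What is left once the third derivatives are eliminated: r, t, w stand for
   F_11, F_12, F_22, and L1, L2 differentiate the coefficients of the soliton
   equation. *)
Lemma jet_identity (R : realType) (J : hyperkahler R) mu (p q r t w : 'rV[R]_4) :
  let K := cplx_comb J mu in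
  let E := dot p p in let F := dot p q in let G := dot q q in
  let D := E * G - F ^+ 2 in
  let E1 := 2 * dot r p in let E2 := 2 * dot t p in
  let F1 := dot r q + dot p t in let F2 := dot t q + dot p w in
  let G1 := 2 * dot t q in let G2 := 2 * dot w q in
  let D1 := E1 * G + E * G1 - 2 * F * F1 in
  let D2 := E2 * G + E * G2 - 2 * F * F2 in
  let h1 := dot (K r) q + dot (K p) t in
  let h2 := dot (K t) q + dot (K p) w in
  let L1 a b c := (- D^-1 ^+ 2 * D1 * G + D^-1 * G1) * a
     - 2 * (- D^-1 ^+ 2 * D1 * F + D^-1 * F1) * b
     + (- D^-1 ^+ 2 * D1 * E + D^-1 * E1) * c in
  let L2 a b c := (- D^-1 ^+ 2 * D2 * G + D^-1 * G2) * a
     - 2 * (- D^-1 ^+ 2 * D2 * F + D^-1 * F2) * b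
     + (- D^-1 ^+ 2 * D2 * E + D^-1 * E2) * c in
  mu != 0 -> dot (K p) q = 0 -> D != 0 ->
  D^-1 * (G * (2 * dot (K r) t) - 2 * F * dot (K r) w + E * (2 * dot (K t) w))
  - D^-1 ^+ 2 * (G * D1 * h1 - F * (D1 * h2 + D2 * h1) + E * D2 * h2)
  = L1 (dot (K r) q) (dot (K t) q) (dot (K w) q)
    + L2 (dot (K p) r) (dot (K p) t) (dot (K p) w).
Proof.
move=> K E F G D E1 E2 F1 F2 G1 G2 D1 D2 h1 h2 L1 L2 mu0 Kpq D0.
rewrite {}/L1 {}/L2 {}/h1 {}/h2.
have basis := adapted_basis mu0 Kpq D0.
have Kuu u : dot (K u) u = 0.
  have := cplx_comb_antisym J mu u u; rewrite (dotC u) -/K => h; lra.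
have Kqp : dot (K q) p = 0 by rewrite cplx_comb_antisym dotC Kpq oppr0.
have KK u v : dot (K u) (K v) = dot mu mu * dot u v by exact: cplx_comb_dot.
have KKl u v : dot (K (K u)) v = - (dot mu mu * dot u v).
  by rewrite cplx_comb_antisym KK.
have KD u v : K (u + v) = K u + K v.
  by rewrite /K /cplx_comb -big_split; apply: eq_bigr => i _; rewrite linearD scalerDr.
have KZ a u : K (a *: u) = a *: K u.
  rewrite /K /cplx_comb scaler_sumr; apply: eq_bigr => i _.
  by rewrite linearZ /= !scalerA mulrC.
have sub u v := dotC u (K v).
(* In the adapted basis every inner product becomes a polynomial in [E, F, G], [dot mu mu] and the
   twelve coordinates, so the claim is a rational identity. *)
have [r1 [r2 [r3 [r4 re]]]] := basis r.
have [t1 [t2 [t3 [t4 te]]]] := basis t.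
have [w1 [w2 [w3 [w4 we]]]] := basis w.
rewrite {}/D1 {}/D2 {}/E1 {}/E2 {}/F1 {}/F2 {}/G1 {}/G2.
have FE : dot q p = F by rewrite dotC.
rewrite {}re {}te {}we !(KD, KZ, dotL) !KK !KKl !sub !(Kuu, Kpq, Kqp, KK, FE).
rewrite -/E -/F -/G in D0 *.
rewrite {}/D in D0 *; clearbody E F G.
by field.
Qed.

(** * Symmetry of second derivatives *)

Lemma is_derive_line (R : realType) (V W : normedModType R) (f : V -> W) (y a : V)
    (r : R) (l : W) :
  is_derive (r *: a + y) a f l ->
  is_derive r 1 (fun h => f (h *: a + y)) l.
Proof.
have e : (fun h : R => h^-1 *: (((fun h => f (h *: a + y)) \o shift r) (h *: 1) - f (r *: a + y)))
       = (fun h => h^-1 *: ((f \o shift (r *: a + y)) (h *: a) - f (r *: a + y))).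
  by apply/funext => h /=; rewrite [h *: 1]mulr1 scalerDl addrA.
by move=> [df dl]; split; rewrite -?dl /derivable /derive e.
Qed.

(** The mean value theorem in direction [a] turns the second difference into [t] times an increment
    of [g] over [t *: b]. Differentiability of [g] at the single point [x] estimates this increment,
    with error at most [e] times the lengths of the two displacements from [x]. *)
Lemma second_difference (R : realType) (V : normedModType R) (f g : V -> R)
    (x a b : V) (e : R) :
  0 < e -> (\forall y \near x, is_derive y a f (g y)) -> differentiable g x ->
  \forall t \near 0^'+, `| (f (t *: a + (t *: b + x)) - f (t *: a + x)
      - f (t *: b + x) + f x) / t ^+ 2 - 'D_b g x | <= e * (2 * `|a| + `|b|).
Proof.
move=> e0 /nbhs_ballP[d1 /= d10 fd] dg.
have /eqaddoP/(_ e e0)/nbhs_ballP[d2 /= d20 gd] := diff_locally dg.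
have {}gd h : `|h| < d2 -> `|g (h + x) - g x - 'd g x h| <= e * `|h|.
  move=> hd; have := gd h; rewrite -ball_normE /= sub0r normrN => /(_ hd).
  by rewrite !fctE /= opprD addrA.
(* [t * n] bounds all displacements [r *: a + s *: b] with [r, s] in [[0, t]]; the summand 1 makes
   the bound strict and keeps [n] positive when [a = b = 0]. *)
pose n := `|a| + `|b| + 1.
have n0 : 0 < n by rewrite ltr_pwDr// addr_ge0.
have na : `|a| < n by rewrite /n -addrA ltrDl ltr_pwDr.
near=> t.
have t0 : 0 < t by near: t; exact: nbhs_right_gt.
have tn1 : t * n < d1 by rewrite -ltr_pdivlMr//; near: t; apply: nbhs_right_lt; rewrite divr_gt0.
have tn2 : t * n < d2 by rewrite -ltr_pdivlMr//; near: t; apply: nbhs_right_lt; rewrite divr_gt0.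
have small r s : 0 <= r <= t -> 0 <= s <= t -> `|r *: a + s *: b| < t * n.
  move=> /andP[r0 rt] /andP[s0 st]; rewrite (le_lt_trans (ler_normD _ _))//.
  rewrite !normrZ !ger0_norm// /n !mulrDr mulr1.
  by rewrite ltr_pwDr// lerD// ler_wpM2r.
have fder r s : 0 <= r <= t -> 0 <= s <= t -> is_derive (r *: a + (s *: b + x)) a f (g (r *: a + (s *: b + x))).
  move=> rt st; apply: fd; rewrite -ball_normE /= addrA distrC addrK.
  exact: lt_trans (small _ _ rt st) tn1.
have tt : 0 <= t <= t by rewrite lexx ltW.
have zt : 0 <= (0 : R) <= t by rewrite lexx ltW.
pose u (h : R) := f (h *: a + (t *: b + x)) - f (h *: a + x).
pose du (h : R) := g (h *: a + (t *: b + x)) - g (h *: a + x).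
have uder h : 0 <= h <= t -> is_derive h 1 u (du h).
  move=> ht; apply: is_deriveB; apply: is_derive_line; first exact: fder.
  by have := fder h 0 ht zt; rewrite scale0r add0r.
have [||r] := @MVT R u du 0 t t0.
- by move=> h; rewrite in_itv /= => /andP[h0 ht]; apply: uder; rewrite !ltW.
- apply: derivable_within_continuous => h; rewrite in_itv /= => ht.
  by case: (uder h ht).
rewrite in_itv /= subr0 => /andP[r0 rt].
have rr : 0 <= r <= t by rewrite !ltW.
rewrite {1 2}/u !scale0r !add0r => ue.
have -> : f (t *: a + (t *: b + x)) - f (t *: a + x) - f (t *: b + x) + f x = du r * t.
  by rewrite -ue; ring.
have -> : 'D_b g x = 'd g x b by rewrite deriveE.
have g1 := gd (r *: a + t *: b) (lt_trans (small _ _ rr tt) tn2).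
have := small r 0 rr zt; rewrite scale0r addr0 => sr.
have g2 := gd (r *: a) (lt_trans sr tn2).
have dE : 'd g x (r *: a + t *: b) = 'd g x (r *: a) + t * 'd g x b.
  by rewrite linearD [X in _ + X]linearZ.
have -> : du r * t / t ^+ 2 - 'd g x b = (du r - t * 'd g x b) / t.
  by field; rewrite gt_eqF.
rewrite normrM [`|t^-1|]gtr0_norm ?invr_gt0// ler_pdivrMr//.
have -> : du r - t * 'd g x b =
    (g (r *: a + t *: b + x) - g x - 'd g x (r *: a + t *: b))
    - (g (r *: a + x) - g x - 'd g x (r *: a)).
  by rewrite /du dE (addrA (r *: a)); ring.
apply: (le_trans (ler_normB _ _)); apply: (le_trans (lerD g1 g2)).
rewrite -mulrDr -mulrA ler_pM2l//.
apply: (le_trans (lerD (ler_normD _ _) (lexx _))).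
rewrite !normrZ !ger0_norm; [|exact: ltW..].
rewrite mulrDl.
have := normr_ge0 a; nra.
Unshelve. all: by end_near. Qed.

(** Young's theorem: the second difference is symmetric in [a] and [b], so one and the same quotient
    approximates both mixed derivatives. *)
Lemma derive_comm (R : realType) (V : normedModType R) (f fa fb : V -> R) (x a b : V) :
  (\forall y \near x, is_derive y a f (fa y)) ->
  (\forall y \near x, is_derive y b f (fb y)) ->
  differentiable fa x -> differentiable fb x -> 'D_a fb x = 'D_b fa x.
Proof.
move=> dfa dfb ga gb; apply/eqP; rewrite -subr_eq0 -normr_le0; apply/ler_addgt0Pr => e e0.
(* The two errors from [second_difference] add up to [e / n * (3 * (|a| + |b|))], which is at most
   [e]. *)
pose n := 3 * (`|a| + `|b|) + 1.
have n0 : 0 < n by rewrite ltr_pwDr// mulr_ge0// addr_ge0.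
have en0 : 0 < e / n by rewrite divr_gt0.
near (0 : R)^'+ => t.
have h1 : `| (f (t *: a + (t *: b + x)) - f (t *: a + x)
      - f (t *: b + x) + f x) / t ^+ 2 - 'D_b fa x | <= e / n * (2 * `|a| + `|b|).
  by near: t; exact: second_difference.
have h2 : `| (f (t *: b + (t *: a + x)) - f (t *: b + x)
      - f (t *: a + x) + f x) / t ^+ 2 - 'D_a fb x | <= e / n * (2 * `|b| + `|a|).
  by near: t; exact: second_difference.
rewrite addrCA [_ - f (t *: b + x) - _]addrAC in h2.
rewrite add0r; set q := _ / t ^+ 2 in h1 h2.
rewrite (le_trans (ler_distD q _ _))// [X in X + _]distrC.
rewrite (le_trans (lerD h2 h1))// -mulrDr mulrAC ler_pdivrMr// ler_pM2l// /n.
lra.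
Unshelve. all: by end_near. Qed.

(** * Componentwise derivatives and smooth maps *)

Lemma is_derive_coord (R : realType) (V : normedModType R) m n
    (f : V -> 'M[R]_(m, n)) (x v : V) (df : 'M[R]_(m, n)) i j :
  is_derive x v f df -> is_derive x v (fun y => f y i j) (df i j).
Proof.
move=> [fx <-]; split; first by move/derivable_mxP: fx; exact.
by rewrite derive_mx// mxE.
Qed.

Lemma is_derive_rowP (R : realType) (V : normedModType R) n
    (f : V -> 'rV[R]_n) (x v : V) (df : 'rV[R]_n) :
  (forall i, is_derive x v (fun y => f y 0 i) (df 0 i)) -> is_derive x v f df.
Proof.
move=> fi; have dfx : derivable f x v.
  by apply/derivable_mxP => i j; rewrite (ord1 i); case: (fi j).
split=> //; rewrite derive_mx//; apply/rowP => j; rewrite mxE.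
by case: (fi j).
Qed.

Lemma smooth_differentiable (R : realType) (V W : normedModType R) (D : set V)
    (f : V -> W) x : smooth_on D f -> D x -> differentiable f x.
Proof. by move=> /(_ 1)[+ _]; exact. Qed.

Lemma smooth_derive (R : realType) (V W : normedModType R) (D : set V)
    (f : V -> W) v : smooth_on D f -> smooth_on D ('D_v f).
Proof. by move=> fs k; have [_] := fs k.+1; exact. Qed.

Lemma smooth_is_derive (R : realType) (V W : normedModType R) (D : set V)
    (f : V -> W) x v : smooth_on D f -> D x -> is_derive x v f ('D_v f x).
Proof.
by move=> fs Dx; apply/derivableP/diff_derivable; exact: smooth_differentiable Dx.
Qed.

Lemma smooth_derive_comm (R : realType) (V : normedModType R) (D : set V) n
    (f : V -> 'rV[R]_n) (x a b : V) :
  open D -> smooth_on D f -> D x -> 'D_a ('D_b f) x = 'D_b ('D_a f) x.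
Proof.
move=> Dopen fs Dx; apply/rowP => i.
have der (u v : V) : is_derive x u (fun y => 'D_v f y 0 i) ('D_u ('D_v f) x 0 i).
  by apply: is_derive_coord; apply: smooth_is_derive Dx; exact: smooth_derive.
have near_der v : \forall y \near x, is_derive y v (fun z => f z 0 i) ('D_v f y 0 i).
  have := open_nbhs_nbhs (conj Dopen Dx); apply: filterS => y Dy.
  by apply: is_derive_coord; exact: smooth_is_derive Dy.
have diff v : differentiable (fun y => 'D_v f y 0 i) x.
  apply: (@differentiable_comp _ _ _ _ ('D_v f) (fun M : 'rV[R]_n => M 0 i)).
    by apply: smooth_differentiable Dx; exact: smooth_derive.
  exact: differentiable_coord.
have [[_ eab] [_ eba]] := (der a b, der b a).
apply: etrans (esym eab) (etrans _ eba).
by apply: derive_comm (near_der a) (near_der b) _ _.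
Qed.

(** * Tangential and normal projections *)

Lemma cap_span_orth (R : realType) m n (A : 'M[R]_(m, n)) :
  (<<A>> :&: kermx A^T = 0)%MS.
Proof.
apply/eqP/rowV0P => v; rewrite sub_capmx genmxE => /andP[/submxP[u vE]].
move=> /sub_kermxP vA; apply/eqP; rewrite -dot_eq0 /dot {2}vE trmx_mul mulmxA.
by rewrite vA mul0mx mxE.
Qed.

(** The two spaces meet trivially and their ranks, [rank A] and [n - rank A], add up to [n]. *)
Lemma span_orth_full (R : realType) m n (A : 'M[R]_(m, n)) (w : 'rV[R]_n) :
  (w <= <<A>> + kermx A^T)%MS.
Proof.
apply: submx_full; rewrite /row_full.
have := mxrank_sum_cap <<A>>%MS (kermx A^T); rewrite cap_span_orth mxrank0 addn0 => ->.
by rewrite mxrank_gen mxrank_ker mxrank_tr subnKC// rank_leq_col.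
Qed.

Lemma tangent_normal_part (R : realType) m n (A : 'M[R]_(m, n)) w :
  tangent_part A w + normal_part A w = w.
Proof. by rewrite add_proj_mx ?cap_span_orth// span_orth_full. Qed.

Lemma tangent_part_sub (R : realType) m n (A : 'M[R]_(m, n)) w :
  (tangent_part A w <= A)%MS.
Proof. by rewrite (submx_trans (proj_mx_sub _ _ _))// genmxE. Qed.

Lemma tangent_part_mul_tr (R : realType) m n (A : 'M[R]_(m, n)) w :
  tangent_part A w *m A^T = w *m A^T.
Proof.
rewrite -{2}(tangent_normal_part A w) mulmxDl.
have /sub_kermxP -> : (normal_part A w <= kermx A^T)%MS by exact: proj_mx_sub.
by rewrite addr0.
Qed.

Lemma normal_part_eq0 (R : realType) m n (A : 'M[R]_(m, n)) w :
  (normal_part A w == 0) = (w <= A)%MS.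
Proof.
apply/eqP/idP => [w0|wA].
  by rewrite -(tangent_normal_part A w) w0 addr0 tangent_part_sub.
by rewrite /normal_part proj_mx_0// ?genmxE// capmxC cap_span_orth.
Qed.

Lemma normal_partD (R : realType) m n (A : 'M[R]_(m, n)) u w :
  normal_part A (u + w) = normal_part A u + normal_part A w.
Proof. exact: mulmxDl. Qed.

(** * Jacobians and the induced metric *)

Lemma delta_mx_form (R : comNzRingType) n (A : 'M[R]_n) i j :
  (delta_mx (0 : 'I_1) i *m A *m (delta_mx (0 : 'I_1) j)^T) 0 0 = A i j.
Proof. by rewrite -rowE trmx_delta -colE !mxE. Qed.

Lemma row_jacobian (R : realType) m n (f : 'rV[R]_m -> 'rV[R]_n) x i :
  differentiable f x -> row i ('J f x) = 'D_(delta_mx 0 i) f x.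
Proof. by move=> fx; rewrite deriveEjacobian// rowE. Qed.

Lemma gram_jacobian (R : realType) m n (f : 'rV[R]_m -> 'rV[R]_n) x :
  differentiable f x ->
  'J f x *m ('J f x)^T =
    \matrix_(i, j) dot ('D_(delta_mx 0 i) f x) ('D_(delta_mx 0 j) f x).
Proof.
move=> fx; apply/matrixP => i j; rewrite !mxE -!row_jacobian// dotE.
by apply: eq_bigr => k _; rewrite !mxE.
Qed.

Lemma immersion_metric (R : realType) (S : oriented_surface R)
    (g : riemannian_metric S) (X : S -> 'rV[R]_4) (c : chart R S) x :
  isometric_immersion g X -> atlas c -> chart_img c x ->
  g c x = 'J (X \o param c) x *m ('J (X \o param c) x)^T.
Proof.
move=> iX cA cx; have [Xs Xg] := iX c cA.
rewrite gram_jacobian; last exact: smooth_differentiable cx.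
by apply/matrixP => i j; rewrite mxE Xg// /inner delta_mx_form.
Qed.

Lemma metric_unitmx (R : realType) (S : oriented_surface R)
    (g : riemannian_metric S) (c : chart R S) x :
  atlas c -> chart_img c x -> g c x \in unitmx.
Proof.
move=> cA cx; rewrite -row_free_unit; apply/inj_row_free => v vg.
apply/eqP; apply: contraT => /(metric_pos g cA cx).
by rewrite vg mul0mx mxE ltxx.
Qed.

(** * The soliton equation in coordinates *)

Lemma derive_sum_delta (R : realType) n (W : normedModType R) (f : 'rV[R]_n -> W) x u :
  differentiable f x ->
  'D_u f x = \sum_i u 0 i *: 'D_(delta_mx 0 i) f x.
Proof.
move=> fx; rewrite deriveE// {1}(row_sum_delta u) linear_sum.
by apply: eq_bigr => i _; rewrite linearZ deriveE.
Qed.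

Lemma is_derive_scale (R : realType) (V : normedModType R) n (k : V -> R)
    (f : V -> 'rV[R]_n) x v dk (df : 'rV[R]_n) :
  is_derive x v k dk -> is_derive x v f df ->
  is_derive x v (fun y => k y *: f y) (dk *: f x + k x *: df).
Proof.
move=> kx fx; apply: is_derive_rowP => i.
rewrite (_ : (fun y => _) = k * (fun y => f y 0 i)); last first.
  by apply/funext => y; rewrite mxE.
apply: is_derive_eq; first exact: is_deriveM kx (is_derive_coord 0 i fx).
by rewrite !mxE addrC /=; congr (_ + _); exact: mulrC.
Qed.

(** In coordinates [H] is the normal part of [g^ij F_ij]: derivatives of the frame components only
    contribute tangential terms, and the frame components combine to the inverse metric. The soliton
    equation then says that the normal part of [V0 + g^ij F_ij] vanishes. *)
Lemma soliton_span (R : realType) (S : oriented_surface R)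
    (g : riemannian_metric S) (X : S -> 'rV[R]_4) V0 (c : chart R S) x :
  translating_soliton g X V0 -> atlas c -> chart_img c x ->
  ((V0 + \sum_i \sum_j invmx (g c x) i j *:
      'D_(delta_mx 0 i) ('D_(delta_mx 0 j) (X \o param c)) x)%R
    <= 'J (X \o param c) x)%MS.
Proof.
move=> [iX sol] cA cx; have [Fs _] := iX c cA.
set F := X \o param c in Fs *.
have dF v y : chart_img c y -> is_derive y v F ('D_v F y).
  by move=> cy; exact: smooth_is_derive cy.
have [e [[D [Dopen Dx Dc es eg]] HE]] := sol c cA x cx.
pose P : 'M[R]_2 := \matrix_i e i x.
(* The rows of [P] are the frame vectors, so orthonormality reads [P g P^T = 1]; a one-sided inverse
   of a square matrix is two-sided. *)
have PgP : invmx (g c x) = P^T *m P.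
  have PG : P *m (g c x *m P^T) = 1%:M.
    apply/matrixP => i j; rewrite [RHS]mxE -(eg x Dx) /inner mulmxA.
    by rewrite -delta_mx_form !mulmxA -rowE rowK -mulmxA -trmx_mul -rowE rowK.
  have := mulmx1C PG; rewrite -mulmxA => gPP.
  by rewrite -[RHS](mulKmx (metric_unitmx g cA cx)) gPP mulmx1.
have SE i : second_fundamental_form X c (e i) (e i) x = normal_part ('J F x)
    (\sum_j \sum_k (e i x 0 j * e i x 0 k) *:
       'D_(delta_mx 0 j) ('D_(delta_mx 0 k) F) x).
  rewrite /second_fundamental_form -/F.
  (* The inner derivative is taken in a direction that varies with [y]; expanding it in the
     coordinate fields leaves products to which the product rule applies. *)
  have near_sum : \forall y \near x, \sum_k e i y 0 k *: 'D_(delta_mx 0 k) F y = 'D_(e i y) F y.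
    have := open_nbhs_nbhs (conj Dopen Dx); apply: filterS => y Dy.
    by rewrite (derive_sum_delta (e i y))//; apply: smooth_differentiable (Dc _ Dy).
  rewrite -(near_eq_derive _ near_sum).
  have der k := is_derive_scale
    (is_derive_coord 0 k (smooth_is_derive (e i x) (es i) Dx))
    (smooth_is_derive (e i x) (smooth_derive (delta_mx 0 k) Fs) cx).
  rewrite (_ : (fun y => _) = \sum_(k < 2) (fun y => e i y 0 k *: 'D_(delta_mx 0 k) F y)); last first.
    by apply/funext => y; rewrite fct_sumE.
  have [_ ->] := is_derive_sum der.
  (* The first sum differentiates the components of [e i]; it is a combination of rows of the
     Jacobian, which the normal projection kills. *)
  rewrite big_split normal_partD [X in X + _ = _](_ : _ = 0) ?add0r.
    congr normal_part; rewrite exchange_big; apply: eq_bigr => k _.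
    rewrite (derive_sum_delta (e i x)); last exact: smooth_differentiable (smooth_derive _ Fs) cx.
    by rewrite scaler_sumr; apply: eq_bigr => j _; rewrite scalerA mulrC.
  apply/eqP; rewrite normal_part_eq0; apply: summx_sub => k _; apply: scalemx_sub.
  by rewrite -row_jacobian ?row_sub//; exact: smooth_differentiable cx.
rewrite -normal_part_eq0 normal_partD addrC addr_eq0 HE -/F.
rewrite (eq_bigr _ (fun i _ => SE i)) /normal_part -mulmx_suml; apply/eqP; congr (_ *m _).
rewrite [RHS]exchange_big; apply: eq_bigr => j _; rewrite [RHS]exchange_big; apply: eq_bigr => k _.
by rewrite PgP mxE -scaler_suml; congr (_ *: _); apply: eq_bigr => i _; rewrite !mxE.
Qed.

(** * Rules for directional derivatives *)

Lemma is_derive_add (R : realType) (V W : normedModType R) (f g : V -> W) x v df dg :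
  is_derive x v f df -> is_derive x v g dg ->
  is_derive x v (fun y => f y + g y) (df + dg).
Proof. exact: is_deriveD. Qed.

Lemma is_derive_mul (R : realType) (V : normedModType R) (f g : V -> R) x v df dg :
  is_derive x v f df -> is_derive x v g dg ->
  is_derive x v (fun y => f y * g y) (df * g x + f x * dg).
Proof.
move=> fx gx; apply: (is_derive_eq (is_deriveM fx gx)).
by rewrite addrC; congr (_ + _); exact: mulrC.
Qed.

Lemma is_derive_opp (R : realType) (V : normedModType R) (f : V -> R) x v df :
  is_derive x v f df -> is_derive x v (fun y => - f y) (- df).
Proof. exact: is_deriveN. Qed.

Lemma is_derive_const (R : realType) (V : normedModType R) (k : R) (x v : V) :
  is_derive x v (fun=> k) 0.
Proof. exact: is_derive_cst. Qed.

Lemma is_derive_inv (R : realType) (V : normedModType R) (f : V -> R) x v df :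
  is_derive x v f df -> f x != 0 ->
  is_derive x v (fun y => (f y)^-1) (- (f x)^-1 ^+ 2 * df).
Proof.
move=> [fx <-] f0; split; first exact: derivableV.
by rewrite deriveV// exprVn.
Qed.

(** Only a directional derivative of [f] is given, so the one-variable chain rule is applied along
    the line through [x] in direction [v]. *)
Lemma is_derive_comp1 (R : realType) (V : normedModType R) (f : V -> R) (g : R -> R) x v df dg :
  is_derive x v f df -> is_derive (f x) 1 g dg ->
  is_derive x v (fun y => g (f y)) (dg * df).
Proof.
move=> fx gx.
have lf : is_derive (0 : R) 1 (fun h => f (h *: v + x)) df.
  by apply: is_derive_line; rewrite scale0r add0r.
have gx' : is_derive (f ((0 : R) *: v + x)) 1 g dg by rewrite scale0r add0r.
have := is_derive1_comp gx' lf.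
have e : (fun h : R => h^-1 *: ((((fun y => g (f y)) \o shift x) (h *: v)) - g (f x)))
    = (fun h => h^-1 *: (((g \o (fun h => f (h *: v + x))) \o shift 0) (h *: 1)
        - (g \o (fun h => f (h *: v + x))) 0)).
  by apply/funext => h /=; rewrite [h *: 1]mulr1 addr0 scale0r add0r.
by move=> [gfx dgf]; split; rewrite -?dgf /derivable /derive e.
Qed.

Lemma is_derive_invsqrt (R : realType) (V : normedModType R) (f : V -> R) x v df :
  is_derive x v f df -> 0 < f x ->
  is_derive x v (fun y => (Num.sqrt (f y))^-1)
    (- 2^-1 * (Num.sqrt (f x))^-1 ^+ 3 * df).
Proof.
move=> fx f0; have s0 : Num.sqrt (f x) != 0 by rewrite gt_eqF ?sqrtr_gt0.
apply: is_derive_eq.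
  exact: (is_derive_inv (is_derive_comp1 fx (is_derive1_sqrt f0)) s0).
by rewrite mulrA; congr (_ * _); move: (Num.sqrt _) s0 => s s0; field.
Qed.

Lemma is_derive_dot (R : realType) (V : normedModType R) n (f g : V -> 'rV[R]_n) x v
    (df dg : 'rV[R]_n) :
  is_derive x v f df -> is_derive x v g dg ->
  is_derive x v (fun y => dot (f y) (g y)) (dot df (g x) + dot (f x) dg).
Proof.
move=> fx gx.
rewrite (_ : (fun y => _) = \sum_i (fun y => f y 0 i * g y 0 i)); last first.
  by apply/funext => y; rewrite dotE fct_sumE.
apply: is_derive_eq.
  apply: is_derive_sum => i.
  exact: is_derive_mul (is_derive_coord 0 i fx) (is_derive_coord 0 i gx).
by rewrite big_split !dotE.
Qed.

Lemma is_derive_dot_const (R : realType) (V : normedModType R) n (f : V -> 'rV[R]_n) x v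
    (df k : 'rV[R]_n) :
  is_derive x v f df -> is_derive x v (fun y => dot (f y) k) (dot df k).
Proof.
move=> fx; apply: is_derive_eq (is_derive_dot fx (is_derive_cst k x v)) _.
by rewrite dot0r addr0.
Qed.

(** * The phase map in a chart *)

Lemma is_derive_cplx (R : realType) (J : hyperkahler R) (V : normedModType R) a
    (f : V -> 'rV[R]_4) x v (df : 'rV[R]_4) :
  is_derive x v f df -> is_derive x v (fun y => J a (f y)) (J a df).
Proof.
(* By antisymmetry each component of [J a u] is an inner product of [u] with a constant vector. *)
have JE u i : J a u 0 i = - dot u (J a (delta_mx 0 i)).
  rewrite -cplx_antisym dotE (bigD1 i)//= mxE !eqxx mulr1 big1 ?addr0// => j /negbTE ji.
  by rewrite mxE ji andbF mulr0.
move=> fx; apply: is_derive_rowP => i; rewrite JE.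
rewrite (_ : (fun y => _) = fun y => - dot (f y) (J a (delta_mx 0 i))).
  by apply: is_derive_opp; exact: is_derive_dot_const.
by apply/funext => y; rewrite JE.
Qed.

(** The phase vector before normalisation: for an oriented orthonormal tangent basis [p, q] it is
    the value of the complex phase map. *)
Definition phase (R : realType) (J : hyperkahler R) (p q : 'rV[R]_4) : 'rV[R]_3 :=
  \row_a dot (J a p) q.

Lemma is_derive_phase (R : realType) (J : hyperkahler R) (V : normedModType R)
    (f g : V -> 'rV[R]_4) x v (df dg : 'rV[R]_4) :
  is_derive x v f df -> is_derive x v g dg ->
  is_derive x v (fun y => phase J (f y) (g y)) (phase J df (g x) + phase J (f x) dg).
Proof.
move=> fx gx; apply: is_derive_rowP => i; rewrite !mxE.
rewrite (_ : (fun y => _) = fun y => dot (J i (f y)) (g y)).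
  exact: is_derive_dot (is_derive_cplx _ _ fx) gx.
by apply/funext => y; rewrite mxE.
Qed.

(** The product rule for [s *: Q] holds on all of the open set [U], so its right-hand side may be
    differentiated again at [x]. *)
Lemma derive2_scale (R : realType) (V : normedModType R) (U : set V) n
    (s sb : V -> R) (f Q Qb : V -> 'rV[R]_n) (x a b : V) sa sab (Qa Qab : 'rV[R]_n) :
  open U -> U x ->
  (forall y, U y -> f y = s y *: Q y) ->
  (forall y, U y -> is_derive y b s (sb y)) ->
  (forall y, U y -> is_derive y b Q (Qb y)) ->
  is_derive x a s sa -> is_derive x a Q Qa ->
  is_derive x a sb sab -> is_derive x a Qb Qab ->
  'D_a ('D_b f) x = sab *: Q x + sb x *: Qa + (sa *: Qb x + s x *: Qab).
Proof.
move=> Uopen Ux fE ds dQ dsa dQa dsb dQb.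
have near_U y (P : V -> Prop) : U y -> (forall z, U z -> P z) -> \forall z \near y, P z.
  by move=> Uy UP; have := open_nbhs_nbhs (conj Uopen Uy); apply: filterS.
have dfb y : U y -> sb y *: Q y + s y *: Qb y = 'D_b f y.
  move=> Uy; rewrite (near_eq_derive b (near_U _ _ Uy fE)).
  by have [_ ->] := is_derive_scale (ds _ Uy) (dQ _ Uy).
rewrite -(near_eq_derive a (near_U _ _ Ux dfb)).
by have [_ ->] := is_derive_add (is_derive_scale dsb dQa) (is_derive_scale dsa dQb).
Qed.

(** The vectors [J_a w] are pairwise orthogonal and as long as [w], so pairing with one of them
    reads off a coefficient of [mu]. *)
Lemma cplx_comb_frame (R : realType) (J : hyperkahler R) mu a w :
  dot (J a w) (cplx_comb J mu w) = mu 0 a * dot w w.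
Proof.
have cross i : i != a -> dot (J i w) (J a w) = 0.
  move=> ia; have e := cplx_antisym J i w (J a w).
  move: e; rewrite (@cplx_anticomm _ J i a)// dotNr opprK -[dot w _]opprK -cplx_antisym.
  by rewrite dotC => h; lra.
rewrite dotC /cplx_comb dot_suml (bigD1 a)//= dotZl cplx_orthogonal big1 ?addr0// => i ia.
by rewrite dotZl cross// mulr0.
Qed.

Lemma det_mx2 (R : comNzRingType) (M : 'M[R]_2) :
  \det M = M 0 0 * M 1 1 - M 0 1 * M 1 0.
Proof.
have l0 : lift (0 : 'I_2) 0 = 1 by exact: val_inj.
have l1 : lift (1 : 'I_2) 0 = 0 by exact: val_inj.
rewrite (expand_det_row _ 0) sum2E /cofactor !det_mx11 !mxE !l0 !l1 /=.
by rewrite expr0 expr1; ring.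
Qed.

Lemma det_col_mx2 (R : comNzRingType) (u v : 'rV[R]_2) :
  \det (col_mx u v : 'M[R]_2) = u 0 0 * v 0 1 - u 0 1 * v 0 0.
Proof.
have M0 j : (col_mx u v : 'M[R]_2) 0 j = u 0 j.
  by rewrite -(col_mxEu u v); congr (col_mx u v _ j); exact: val_inj.
have M1 j : (col_mx u v : 'M[R]_2) 1 j = v 0 j.
  by rewrite -(col_mxEd u v); congr (col_mx u v _ j); exact: val_inj.
by rewrite det_mx2 !M0 !M1.
Qed.

(** Gram-Schmidt turns the coordinate fields into an oriented orthonormal frame [u, v]. The
    orientation clause gives [sum_a lambda_a J_a (dX u) = dX v], and pairing with [J_a (dX u)]
    isolates [lambda_a]. *)
Lemma complex_phaseE (R : realType) (J : hyperkahler R) (S : oriented_surface R)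
    (g : riemannian_metric S) (X : S -> 'rV[R]_4) (phi : S -> 'rV[R]_3)
    (c : chart R S) x :
  isometric_immersion g X -> is_complex_phase_map J g X phi ->
  atlas c -> chart_img c x ->
  let p := 'D_(delta_mx 0 0) (X \o param c) x in
  let q := 'D_(delta_mx 0 1) (X \o param c) x in
  0 < dot p p -> 0 < dot p p * dot q q - dot p q ^+ 2 ->
  phi (param c x) = (Num.sqrt (dot p p * dot q q - dot p q ^+ 2))^-1 *: phase J p q.
Proof.
move=> iX phiP cA cx p q; have [Fs Fg] := iX c cA.
have [_ _ phi3] := phiP c cA x cx.
have dX w : 'D_w (X \o param c) x = w 0 0 *: p + w 0 1 *: q.
  by rewrite derive_sum_delta ?sum2E//; exact: smooth_differentiable cx.
clearbody p q.
set E := dot p p; set F := dot p q; set G := dot q q => E0 D0.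
set e := Num.sqrt E; set d := Num.sqrt (E * G - F ^+ 2).
have e0 : e != 0 by rewrite gt_eqF ?sqrtr_gt0.
have d0 : d != 0 by rewrite gt_eqF ?sqrtr_gt0.
have eE : e ^+ 2 = E by rewrite sqr_sqrtr// ltW.
have dE : d ^+ 2 = E * G - F ^+ 2 by rewrite sqr_sqrtr// ltW.
(* Gram-Schmidt in chart components, with [e = |p|] and [d] the area of the parallelogram on [p, q];
   the determinant of the pair is [d^-1], hence the orientation is right. *)
pose u : 'rV[R]_2 := e^-1 *: delta_mx 0 0.
pose v : 'rV[R]_2 := (e * d)^-1 *: (E *: delta_mx 0 1 - F *: delta_mx 0 0).
have uE : 'D_u (X \o param c) x = e^-1 *: p.
  by rewrite dX !mxE /= mulr1 mulr0 scale0r addr0.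
have vE : 'D_v (X \o param c) x = (e * d)^-1 *: (E *: q - F *: p).
  by rewrite dX !mxE /= !mulr1 !mulr0 subr0 sub0r scalerBr !scalerA addrC mulrN scaleNr.
have /phi3 phiE : oriented_orthonormal g c x u v.
  split.
  - by rewrite -Fg// uE !dotL -/E -eE; field.
  - rewrite -Fg// vE !dotL -/E -/G (dotC q p) -/F.
    rewrite (_ : (e * d)^-1 * _ = E * (E * G - F ^+ 2) / (e ^+ 2 * d ^+ 2)).
      by rewrite eE dE; field; rewrite !gt_eqF.
    by field; rewrite e0 d0.
  - by rewrite -Fg// uE vE !dotL -/E -/F; ring.
  - rewrite det_col_mx2 !mxE /= (_ : _ - _ = d^-1) ?invr_gt0 ?sqrtr_gt0//.
    by rewrite -eE; field; rewrite e0 d0.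
have Jpp a : dot (J a p) p = 0.
  by have := cplx_antisym J a p p; rewrite (dotC p) => h; lra.
apply/rowP => a; rewrite !mxE.
have := cplx_comb_frame J (phi (param c x)) a ('D_u (X \o param c) x).
rewrite phiE uE vE linearZ !dotL -/E Jpp mulr0 subr0.
have -> : e^-1 * (e^-1 * E) = 1 by rewrite -eE; field.
rewrite mulr1 => <-; rewrite -eE /=; field.
by rewrite e0 d0.
Qed.

(** * Gram determinant and second-order jet of the phase map *)

Definition gram (R : realType) n (p q : 'rV[R]_n) : R :=
  dot p p * dot q q - dot p q ^+ 2.

(** The derivative [E' G + E G' - 2 F F'] of [E G - F^2] when [p, q] move with velocities
    [dp, dq]. *)
Definition dgram (R : realType) n (p q dp dq : 'rV[R]_n) : R :=
  2 * dot dp p * dot q q + dot p p * (2 * dot dq q)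
  - 2 * dot p q * (dot dp q + dot p dq).

Lemma is_derive_gram (R : realType) (V : normedModType R) n (p q : V -> 'rV[R]_n) x v
    (dp dq : 'rV[R]_n) :
  is_derive x v p dp -> is_derive x v q dq ->
  is_derive x v (fun y => gram (p y) (q y)) (dgram (p x) (q x) dp dq).
Proof.
move=> px qx; have pp := is_derive_dot px px; have pq := is_derive_dot px qx.
have qq := is_derive_dot qx qx.
under [X in is_derive _ _ X]eq_fun do rewrite /gram expr2.
apply: (is_derive_eq (is_derive_add (is_derive_mul pp qq) (is_derive_opp (is_derive_mul pq pq)))).
by rewrite /dgram (dotC (p x) dp) (dotC (q x) dq) (dotC (p x) (q x)); ring.
Qed.

Lemma dot_phase (R : realType) (J : hyperkahler R) mu p q :
  dot (phase J p q) mu = dot (cplx_comb J mu p) q.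
Proof.
by rewrite /cplx_comb dot_suml dotE; apply: eq_bigr => a _; rewrite dotZl mxE mulrC.
Qed.

(** The existence of a derivative suffices: in the second derivative of the phase map its value ends
    up multiplied by [<K p, q> = 0]. *)
Lemma derivable_dgram (R : realType) (V : normedModType R) n (p q dp dq : V -> 'rV[R]_n) x v
    (pv qv dpv dqv : 'rV[R]_n) :
  is_derive x v p pv -> is_derive x v q qv ->
  is_derive x v dp dpv -> is_derive x v dq dqv ->
  exists d, is_derive x v (fun y => dgram (p y) (q y) (dp y) (dq y)) d.
Proof.
move=> px qx dpx dqx; eexists; rewrite /dgram.
apply: is_derive_add; first apply: is_derive_add.
- apply: is_derive_mul (is_derive_dot qx qx).
  exact: is_derive_mul (is_derive_const _ _ _) (is_derive_dot dpx px).
- apply: is_derive_mul (is_derive_dot px px) _.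
  exact: is_derive_mul (is_derive_const _ _ _) (is_derive_dot dqx qx).
apply: is_derive_opp; apply: is_derive_mul.
  exact: is_derive_mul (is_derive_const _ _ _) (is_derive_dot px qx).
exact: is_derive_add (is_derive_dot dpx qx) (is_derive_dot px dqx).
Qed.

(** Here [f = s *: Q] where [<Q, mu> = <K p, q>] vanishes at [x], so all terms in which [Q] stays
    undifferentiated drop out. The factor [- 2^-1 * s ^+ 3] comes from differentiating
    [s = gram^(-1/2)]. *)
Lemma phase_map_jet (R : realType) (J : hyperkahler R) (V : normedModType R) (U : set V)
    (p q pb qb : V -> 'rV[R]_4) (f : V -> 'rV[R]_3) mu x a b
    (pa qa pab qab : 'rV[R]_4) :
  let K := cplx_comb J mu in
  let s y := (Num.sqrt (gram (p y) (q y)))^-1 in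
  open U -> U x ->
  (forall y, U y -> 0 < gram (p y) (q y)) ->
  (forall y, U y -> f y = s y *: phase J (p y) (q y)) ->
  (forall y, U y -> is_derive y b p (pb y)) ->
  (forall y, U y -> is_derive y b q (qb y)) ->
  is_derive x a p pa -> is_derive x a q qa ->
  is_derive x a pb pab -> is_derive x a qb qab ->
  dot (K (p x)) (q x) = 0 ->
  dot ('D_b f x) mu = s x * (dot (K (pb x)) (q x) + dot (K (p x)) (qb x)) /\
  dot ('D_a ('D_b f) x) mu =
    - 2^-1 * s x ^+ 3 *
      (dgram (p x) (q x) (pb x) (qb x) * (dot (K pa) (q x) + dot (K (p x)) qa)
       + dgram (p x) (q x) pa qa * (dot (K (pb x)) (q x) + dot (K (p x)) (qb x)))
    + s x * (dot (K pab) (q x) + dot (K (pb x)) qa + (dot (K pa) (qb x) + dot (K (p x)) qab)).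
Proof.
move=> K s Uopen Ux gpos fE dp dq px qx pbx qbx Kpq.
have ds y : U y -> is_derive y b s (- 2^-1 * s y ^+ 3 * dgram (p y) (q y) (pb y) (qb y)).
  by move=> Uy; exact: (is_derive_invsqrt (is_derive_gram (dp _ Uy) (dq _ Uy)) (gpos _ Uy)).
have dQ y : U y -> is_derive y b (fun y => phase J (p y) (q y))
    (phase J (pb y) (q y) + phase J (p y) (qb y)).
  by move=> Uy; apply: is_derive_phase; auto.
have sx := is_derive_invsqrt (is_derive_gram px qx) (gpos _ Ux).
have [dg dgx] := derivable_dgram px qx pbx qbx.
split.
  have := open_nbhs_nbhs (conj Uopen Ux) => nbU.
  have fnear : \forall y \near x, s y *: phase J (p y) (q y) = f y.
    by apply: filterS nbU => y /fE.
  rewrite -(near_eq_derive b fnear); have [_ ->] := is_derive_scale (ds _ Ux) (dQ _ Ux).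
  by rewrite !dotL !dot_phase -/K Kpq mulr0 add0r.
have [sab dsb] : exists d, is_derive x a
    (fun y => - 2^-1 * s y ^+ 3 * dgram (p y) (q y) (pb y) (qb y)) d.
  have s3 : is_derive x a (fun y => s y ^+ 3) _ := is_derive_mul sx (is_derive_mul sx sx).
  by eexists; exact: (is_derive_mul (is_derive_mul (is_derive_const (- 2^-1) x a) s3) dgx).
have dQb := is_derive_add (is_derive_phase J pbx qx) (is_derive_phase J px qbx).
rewrite (derive2_scale Uopen Ux fE ds dQ sx (is_derive_phase J px qx) dsb dQb).
rewrite !dotL !dot_phase -/K -/(s x) Kpq; move: (s x) => sx0.
ring.
Qed.

(** This is what eliminates third derivatives of the immersion: the constant [V0] disappears under
    differentiation, and a vector [k] normal at [x] removes the unknown derivatives of the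
    tangential coefficients. *)
Lemma soliton_equation_derive (R : realType) (V : normedModType R) (U : set V) n
    (p q r t w : V -> 'rV[R]_n) (V0 : 'rV[R]_n) x v (z1 z2 : R)
    (pv qv rv tv wv k : 'rV[R]_n) :
  let E y := dot (p y) (p y) in let F y := dot (p y) (q y) in
  let G y := dot (q y) (q y) in let D y := gram (p y) (q y) in
  let L y := (D y)^-1 *: (G y *: r y - (2 * F y) *: t y + E y *: w y) in
  let Ev := 2 * dot pv (p x) in let Fv := dot pv (q x) + dot (p x) qv in
  let Gv := 2 * dot qv (q x) in let Dv := dgram (p x) (q x) pv qv in
  open U -> U x ->
  (forall y, U y -> 0 < D y) ->
  (forall y, U y -> exists z1 z2, V0 + L y = z1 *: p y + z2 *: q y) ->
  V0 + L x = z1 *: p x + z2 *: q x ->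
  is_derive x v p pv -> is_derive x v q qv ->
  is_derive x v r rv -> is_derive x v t tv -> is_derive x v w wv ->
  dot (p x) k = 0 -> dot (q x) k = 0 ->
  (D x)^-1 * (G x * dot rv k - 2 * F x * dot tv k + E x * dot wv k)
  + ((- (D x)^-1 ^+ 2 * Dv * G x + (D x)^-1 * Gv) * dot (r x) k
     - 2 * (- (D x)^-1 ^+ 2 * Dv * F x + (D x)^-1 * Fv) * dot (t x) k
     + (- (D x)^-1 ^+ 2 * Dv * E x + (D x)^-1 * Ev) * dot (w x) k)
  = z1 * dot pv k + z2 * dot qv k.
Proof.
move=> E F G D L Ev Fv Gv Dv Uopen Ux Dpos Leq Lx px qx rx tx wx pk qk.
(* The tangential coefficients are differentiable in y, but their derivatives
   are multiplied by <p, k> = <q, k> = 0 at x. *)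
pose Z1 y := (D y)^-1 * (G y * dot (V0 + L y) (p y) - F y * dot (V0 + L y) (q y)).
pose Z2 y := (D y)^-1 * (E y * dot (V0 + L y) (q y) - F y * dot (V0 + L y) (p y)).
have ZE y a b : U y -> V0 + L y = a *: p y + b *: q y -> Z1 y = a /\ Z2 y = b.
  move=> Uy e; have D0 : D y != 0 by rewrite gt_eqF ?Dpos.
  rewrite /Z1 /Z2 e !dotL (dotC (q y) (p y)) -/(E y) -/(F y) -/(G y).
  rewrite /D /gram -/(E y) -/(F y) -/(G y) in D0 *.
  by split; field.
have Ex : is_derive x v E Ev.
  by apply: is_derive_eq (is_derive_dot px px) _; rewrite dotC /Ev (dotC pv); ring.
have Gx : is_derive x v G Gv.
  by apply: is_derive_eq (is_derive_dot qx qx) _; rewrite dotC /Gv (dotC qv); ring.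
have Fx : is_derive x v F Fv := is_derive_dot px qx.
have Dx : is_derive x v (fun y => (D y)^-1) (- (D x)^-1 ^+ 2 * Dv).
  by apply: is_derive_inv (is_derive_gram px qx) _; rewrite gt_eqF ?Dpos.
have Fx2 := is_derive_mul (is_derive_const 2 x v) Fx.
have [l Lv] : exists l : 'rV[R]_n, is_derive x v (fun y => V0 + L y) l.
  eexists; exact: (is_derive_add (is_derive_cst V0 x v) (is_derive_scale Dx
    (is_derive_add (is_derive_add (is_derive_scale Gx rx)
       (is_deriveN (is_derive_scale Fx2 tx))) (is_derive_scale Ex wx)))).
have [Z1v Z1x] : exists d, is_derive x v Z1 d.
  eexists; apply: is_derive_mul Dx _.
  apply: is_derive_add (is_derive_mul Gx (is_derive_dot Lv px)) _.
  exact: is_derive_opp (is_derive_mul Fx (is_derive_dot Lv qx)).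
have [Z2v Z2x] : exists d, is_derive x v Z2 d.
  eexists; apply: is_derive_mul Dx _.
  apply: is_derive_add (is_derive_mul Ex (is_derive_dot Lv qx)) _.
  exact: is_derive_opp (is_derive_mul Fx (is_derive_dot Lv px)).
(* Both sides are paired with the fixed [k] first, which leaves scalar functions that agree near
   [x]. *)
pose lhs y := dot V0 k + (D y)^-1 * (G y * dot (r y) k + - (2 * F y * dot (t y) k)
   + E y * dot (w y) k).
pose rhs y := Z1 y * dot (p y) k + Z2 y * dot (q y) k.
have near_e : \forall y \near x, lhs y = rhs y.
  apply: filterS (open_nbhs_nbhs (conj Uopen Ux)) => y Uy.
  have [a [b e]] := Leq _ Uy; have [e1 e2] := ZE _ _ _ Uy e.
  by rewrite /rhs e1 e2 -!dotZl -dotDl -e /L !dotL /lhs; ring.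
have lhsx : is_derive x v lhs _ :=
  is_derive_add (is_derive_const (dot V0 k) x v) (is_derive_mul Dx
    (is_derive_add (is_derive_add (is_derive_mul Gx (is_derive_dot_const k rx))
       (is_derive_opp (is_derive_mul Fx2 (is_derive_dot_const k tx))))
     (is_derive_mul Ex (is_derive_dot_const k wx)))).
have rhsx : is_derive x v rhs _ :=
  is_derive_add (is_derive_mul Z1x (is_derive_dot_const k px))
    (is_derive_mul Z2x (is_derive_dot_const k qx)).
have [_ le] := lhsx; have [_ re] := rhsx.
have := near_eq_derive v near_e; rewrite le re pk qk.
have [-> ->] := ZE _ _ _ Ux Lx.
rewrite !mulr0 !add0r => <-; ring.
Qed.

(** The jets of [f] contain the third derivatives [c0, ..., c3]. The soliton equation differentiated
    along [a] and paired with [K q], and along [b] and paired with [K p], replaces them; what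
    remains is [jet_identity]. *)
Lemma phase_map_laplacian (R : realType) (J : hyperkahler R) (V : normedModType R)
    (U : set V) (p q r t w : V -> 'rV[R]_4) (f : V -> 'rV[R]_3) (V0 : 'rV[R]_4) mu x a b
    (c0 c1 c2 c3 : 'rV[R]_4) (z1 z2 : R) :
  let E y := dot (p y) (p y) in let F y := dot (p y) (q y) in
  let G y := dot (q y) (q y) in let D y := gram (p y) (q y) in
  let L y := (D y)^-1 *: (G y *: r y - (2 * F y) *: t y + E y *: w y) in
  open U -> U x ->
  (forall y, U y -> 0 < D y) ->
  (forall y, U y -> f y = (Num.sqrt (D y))^-1 *: phase J (p y) (q y)) ->
  (forall y, U y -> exists z1 z2, V0 + L y = z1 *: p y + z2 *: q y) ->
  V0 + L x = z1 *: p x + z2 *: q x ->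
  (forall y, U y -> is_derive y a p (r y)) ->
  (forall y, U y -> is_derive y b p (t y)) ->
  (forall y, U y -> is_derive y a q (t y)) ->
  (forall y, U y -> is_derive y b q (w y)) ->
  is_derive x a r c0 -> is_derive x b r c1 ->
  is_derive x a t c1 -> is_derive x b t c2 ->
  is_derive x a w c2 -> is_derive x b w c3 ->
  mu != 0 -> dot (f x) mu = 0 ->
  (D x)^-1 * (G x * dot ('D_a ('D_a f) x) mu
    - F x * (dot ('D_a ('D_b f) x) mu + dot ('D_b ('D_a f) x) mu)
    + E x * dot ('D_b ('D_b f) x) mu)
  = z1 * dot ('D_a f x) mu + z2 * dot ('D_b f x) mu.
Proof.
move=> E F G D L Uopen Ux Dpos fE Leq Lx pa pb qa qb ra rb ta tb wa wb mu0 fmu.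
pose K := cplx_comb J mu.
have D0 := Dpos _ Ux.
have s0 : (Num.sqrt (D x))^-1 != 0 by rewrite invr_eq0 gt_eqF ?sqrtr_gt0.
have Kpq : dot (K (p x)) (q x) = 0.
  by apply: (mulfI s0); rewrite mulr0 -fmu (fE _ Ux) !dotL dot_phase.
have Kuu u : dot u (K u) = 0.
  have := cplx_comb_antisym J mu u u; rewrite (dotC _ u) -/K => h; lra.
have Kl u v : dot u (K v) = - dot (K u) v by rewrite cplx_comb_antisym opprK.
have Kqp : dot (K (q x)) (p x) = 0 by rewrite cplx_comb_antisym dotC Kpq oppr0.
have [ea eaa] := phase_map_jet Uopen Ux Dpos fE pa qa (pa _ Ux) (qa _ Ux) ra ta Kpq.
have [eb eab] := phase_map_jet Uopen Ux Dpos fE pb qb (pa _ Ux) (qa _ Ux) ta wa Kpq.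
have [_ eba] := phase_map_jet Uopen Ux Dpos fE pa qa (pb _ Ux) (qb _ Ux) rb tb Kpq.
have [_ ebb] := phase_map_jet Uopen Ux Dpos fE pb qb (pb _ Ux) (qb _ Ux) tb wb Kpq.
move: eaa eab eba ebb ea eb.
generalize (dot ('D_a ('D_a f) x) mu) (dot ('D_a ('D_b f) x) mu)
  (dot ('D_b ('D_a f) x) mu) (dot ('D_b ('D_b f) x) mu) (dot ('D_a f x) mu) (dot ('D_b f x) mu).
move=> faa fab fba fbb fa fb -> -> -> -> -> -> {faa fab fba fbb fa fb}.
have pKq : dot (p x) (K (q x)) = 0 by rewrite dotC.
have qKp : dot (q x) (K (p x)) = 0 by rewrite dotC.
have := soliton_equation_derive Uopen Ux Dpos Leq Lx (pa _ Ux) (qa _ Ux) ra ta wa pKq (Kuu _).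
have := soliton_equation_derive Uopen Ux Dpos Leq Lx (pb _ Ux) (qb _ Ux) rb tb wb (Kuu _) qKp.
have Dx0 : dot (p x) (p x) * dot (q x) (q x) - dot (p x) (q x) ^+ 2 != 0 by rewrite gt_eqF.
have := jet_identity (r x) (t x) (w x) mu0 Kpq Dx0.
rewrite -/K -/(gram (p x) (q x)) -/(D x).
have -> : 2 * dot (r x) (p x) * dot (q x) (q x) + dot (p x) (p x) * (2 * dot (t x) (q x))
  - 2 * dot (p x) (q x) * (dot (r x) (q x) + dot (p x) (t x)) = dgram (p x) (q x) (r x) (t x) by [].
have -> : 2 * dot (t x) (p x) * dot (q x) (q x) + dot (p x) (p x) * (2 * dot (w x) (q x))
  - 2 * dot (p x) (q x) * (dot (t x) (q x) + dot (p x) (w x)) = dgram (p x) (q x) (t x) (w x) by [].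
(* Writing [D^-1] as [s ^+ 2] leaves polynomial expressions in [s] only. *)
have De : (D x)^-1 = (Num.sqrt (D x))^-1 ^+ 2 by rewrite exprVn sqr_sqrtr// ltW.
rewrite -/(D x) {}De -/(E x) -/(F x) -/(G x) !(Kl _ (q x)) !(dotC _ (K (p x))).
move: (Num.sqrt (D x))^-1 => s.
have -> : dot (K (t x)) (t x) = 0 by rewrite dotC.
have swap : dot (K (w x)) (r x) = - dot (K (r x)) (w x) by rewrite dotC Kl.
have swap2 : dot (K (w x)) (t x) = - dot (K (t x)) (w x) by rewrite dotC Kl.
have swap3 : dot (K (t x)) (r x) = - dot (K (r x)) (t x) by rewrite dotC Kl.
rewrite ?swap ?swap2 ?swap3.
(* The goal carries one more factor [s] than the three identities; after multiplying them by [s] it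
   is a linear combination of them. *)
move=> /(congr1 ( *%R s)) jet /(congr1 ( *%R s)) eqb /(congr1 ( *%R s)) eqa.
lra.
Qed.

(** * Inverse metric and Christoffel symbols *)

Lemma sum_invmx2 (R : comUnitRingType) (V : lmodType R) (M : 'M[R]_2)
    (T : 'I_2 -> 'I_2 -> V) : M \in unitmx ->
  \sum_i \sum_j invmx M i j *: T i j =
  (\det M)^-1 *: (M 1 1 *: T 0 0 - M 0 1 *: T 0 1 - M 1 0 *: T 1 0 + M 0 0 *: T 1 1).
Proof.
move=> Mu; have l0 : lift (0 : 'I_2) 0 = 1 by exact: val_inj.
have l1 : lift (1 : 'I_2) 0 = 0 by exact: val_inj.
rewrite /invmx Mu !sum2E !mxE /cofactor !det_mx11 !mxE !l0 !l1 /=.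
rewrite expr0 expr1 sqrrN expr1n !mul1r !mulN1r.
by rewrite !(scalerDr, scalerN, scalerA) !mulrN !scaleNr !addrA.
Qed.

Lemma immersion_det (R : realType) (S : oriented_surface R)
    (g : riemannian_metric S) (X : S -> 'rV[R]_4) (c : chart R S) x :
  isometric_immersion g X -> atlas c -> chart_img c x ->
  \det (g c x) = gram ('D_(delta_mx 0 0) (X \o param c) x) ('D_(delta_mx 0 1) (X \o param c) x).
Proof.
move=> iX cA cx; have [Fs _] := iX c cA.
rewrite (immersion_metric iX cA cx) gram_jacobian; last exact: smooth_differentiable cx.
rewrite det_mx2 !mxE /gram.
move: ('D_(delta_mx 0 0) _ _) ('D_(delta_mx 0 1) _ _) => p q.
by rewrite (dotC q p) expr2.
Qed.

(** With [E, F, G] the inner products of [p, q], the squared length of [E q - F p] is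
    [E (E G - F^2)]; and [p = 0] would make [gram] vanish. *)
Lemma gram_gt0 (R : realType) n (p q : 'rV[R]_n) : gram p q != 0 ->
  0 < dot p p /\ 0 < gram p q.
Proof.
move=> g0; have p0 : 0 < dot p p.
  rewrite lt_def dot_ge0 andbT; apply: contra g0; rewrite dot_eq0 => /eqP ->.
  by rewrite /gram !dot0l mul0r expr0n subr0.
split=> //; rewrite lt_def g0 /=.
have := dot_ge0 (dot p p *: q - dot p q *: p); rewrite !dotL (dotC q p) => h.
rewrite -(pmulr_rge0 _ p0) /gram.
by apply: le_trans h _; rewrite le_eqVlt; apply/orP; left; apply/eqP; ring.
Qed.

(** Differentiating [g_jl = <F_j, F_l>] and using the symmetry of [F_ij], all terms cancel in the
    Koszul combination except [2 <F_ij, F_l>]. *)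
Lemma christoffelE (R : realType) (S : oriented_surface R)
    (g : riemannian_metric S) (X : S -> 'rV[R]_4) (c : chart R S) x i j k :
  isometric_immersion g X -> atlas c -> chart_img c x ->
  christoffel g c x i j k = \sum_l invmx (g c x) k l *
    dot ('D_(delta_mx 0 i) ('D_(delta_mx 0 j) (X \o param c)) x)
        ('D_(delta_mx 0 l) (X \o param c) x).
Proof.
move=> iX cA cx; have [Fs _] := iX c cA; set F := X \o param c in Fs *.
have dg u v h : 'D_(delta_mx 0 u) (fun y => g c y v h) x =
    dot ('D_(delta_mx 0 u) ('D_(delta_mx 0 v) F) x) ('D_(delta_mx 0 h) F x)
    + dot ('D_(delta_mx 0 v) F x) ('D_(delta_mx 0 u) ('D_(delta_mx 0 h) F) x).
  have near_g : \forall y \near x,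
      dot ('D_(delta_mx 0 v) F y) ('D_(delta_mx 0 h) F y) = g c y v h.
    apply: filterS (open_nbhs_nbhs (conj (@chart_img_open _ _ c) cx)) => y cy.
    rewrite (immersion_metric iX cA cy) gram_jacobian ?mxE//.
    exact: smooth_differentiable cy.
  rewrite -(near_eq_derive _ near_g).
  by have [_ ->] := is_derive_dot
    (smooth_is_derive (delta_mx 0 u) (smooth_derive (delta_mx 0 v) Fs) cx)
    (smooth_is_derive (delta_mx 0 u) (smooth_derive (delta_mx 0 h) Fs) cx).
have Tsym u v : 'D_(delta_mx 0 u) ('D_(delta_mx 0 v) F) x = 'D_(delta_mx 0 v) ('D_(delta_mx 0 u) F) x.
  exact: smooth_derive_comm (@chart_img_open _ _ c) Fs cx.
move: dg Tsym; rewrite /christoffel.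
pose T u v := 'D_(delta_mx 0 u) ('D_(delta_mx 0 v) F) x; pose Fd u := 'D_(delta_mx 0 u) F x.
move=> dg Tsym; have {}Tsym u v : T u v = T v u by exact: Tsym.
have {}dg u v h : 'D_(delta_mx 0 u) (fun y => g c y v h) x = dot (T u v) (Fd h) + dot (Fd v) (T u h).
  exact: dg.
rewrite mulr_sumr; apply: eq_bigr => l _; rewrite !dg -/(T i j) -/(Fd l).
clearbody T Fd.
rewrite (Tsym j i) (Tsym l i) (Tsym l j) !(dotC (Fd _)).
move: (dot _ _) (dot _ _) (dot _ _) (invmx _ _ _) => A B C D.
by field.
Qed.

(** Pairing with the coordinate fields identifies both summands: [V0] contributes only through its
    tangential part, and [<F_ij, F_l>] are lowered Christoffel symbols by [christoffelE]. *)
Lemma soliton_components (R : realType) (S : oriented_surface R)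
    (g : riemannian_metric S) (X : S -> 'rV[R]_4) V0 (c : chart R S) x (z : 'rV[R]_2) :
  isometric_immersion g X -> atlas c -> chart_img c x ->
  V0 + \sum_i \sum_j invmx (g c x) i j *:
      'D_(delta_mx 0 i) ('D_(delta_mx 0 j) (X \o param c)) x = z *m 'J (X \o param c) x ->
  z = tangent_components X c x V0
    + \row_k \sum_i \sum_j invmx (g c x) i j * christoffel g c x i j k.
Proof.
move=> iX cA cx; have [Fs _] := iX c cA.
have := fun i j k => @christoffelE R S g X c x i j k iX cA cx.
have JF i := row_jacobian i (smooth_differentiable Fs cx).
have gJ := immersion_metric iX cA cx; have gu := metric_unitmx g cA cx.
pose T i j := 'D_(delta_mx 0 i) ('D_(delta_mx 0 j) (X \o param c)) x.
rewrite /tangent_components; set Jx := 'J (X \o param c) x in JF gJ *.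
(* The metric is invertible and equals [Jx *m Jx^T], so the components may be compared after
   lowering the index. *)
move=> chE zE; apply: (can_inj (mulmxK gu)); rewrite [in LHS]gJ mulmxA -zE.
have tJ : tangent_part Jx V0 *m pinvmx Jx *m g c x = V0 *m Jx^T.
  by rewrite gJ mulmxA mulmxKpV ?tangent_part_sub// tangent_part_mul_tr.
rewrite mulmxDl [in RHS]mulmxDl tJ; congr (_ + _).
have gs : (invmx (g c x))^T = invmx (g c x).
  by rewrite trmx_inv gJ trmx_mul trmxK.
have rowG i j : (\row_k christoffel g c x i j k) *m g c x = T i j *m Jx^T.
  have -> : \row_k christoffel g c x i j k = T i j *m Jx^T *m invmx (g c x).
    apply/rowP => k; rewrite !mxE chE; apply: eq_bigr => l _.
    have -> : invmx (g c x) k l = invmx (g c x) l k by rewrite -{1}gs mxE.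
    rewrite mulrC; congr (_ * _).
    by rewrite !mxE dotE; apply: eq_bigr => h _; rewrite -JF !mxE.
  by rewrite mulmxKV.
rewrite (_ : \row_k _ = \sum_i \sum_j invmx (g c x) i j *: \row_k christoffel g c x i j k).
  rewrite !mulmx_suml; apply: eq_bigr => i _; rewrite !mulmx_suml; apply: eq_bigr => j _.
  by rewrite -!scalemxAl rowG.
apply/rowP => k; rewrite mxE summxE; apply: eq_bigr => i _; rewrite summxE.
by apply: eq_bigr => j _; rewrite !mxE.
Qed.

(** * Sphere-valued maps and the tension field *)

Lemma dot_sphere_tangent_part (R : realType) n (q w d : 'rV[R]_n) :
  dot q d = 0 -> dot (sphere_tangent_part q w) d = dot w d.
Proof. by move=> qd; rewrite !dotL qd mulr0 subr0. Qed.

Lemma sphere_tangent_part_orth (R : realType) n (q w : 'rV[R]_n) :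
  dot q q = 1 -> dot q (sphere_tangent_part q w) = 0.
Proof. by move=> qq; rewrite !dotL qq mulr1 dotC subrr. Qed.

Lemma sphere_derive_orth (R : realType) (V : normedModType R) n (U : set V)
    (f : V -> 'rV[R]_n) x v :
  open U -> U x -> (forall y, U y -> dot (f y) (f y) = 1) ->
  derivable f x v -> dot (f x) ('D_v f x) = 0.
Proof.
move=> Uopen Ux f1 /derivableP fx.
have near1 : \forall y \near x, dot (f y) (f y) = cst 1 y.
  by apply: filterS (open_nbhs_nbhs (conj Uopen Ux)) => y /f1.
have := near_eq_derive v near1; rewrite derive_cst.
have [_ ->] := is_derive_dot fx fx; rewrite (dotC _ (f x)) => h; lra.
Qed.

(** A [d] orthogonal to the value of [f] does not see the sphere projection. Exchanging the sums
    collects the contraction [g^ij Gamma_ij^k] that also occurs in [soliton_components]. *)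
Lemma tension_dot (R : realType) (S : oriented_surface R)
    (g : riemannian_metric S) n (f : S -> 'rV[R]_n) (c : chart R S) x (d : 'rV[R]_n) :
  dot (f (param c x)) d = 0 ->
  dot (tension g f c x) d =
    \sum_i \sum_j invmx (g c x) i j * dot ('D_(delta_mx 0 i) ('D_(delta_mx 0 j) (f \o param c)) x) d
    - \sum_k (\sum_i \sum_j invmx (g c x) i j * christoffel g c x i j k)
        * dot ('D_(delta_mx 0 k) (f \o param c) x) d.
Proof.
move=> fd; rewrite /tension dot_suml.
under [X in _ - X]eq_bigr do rewrite mulr_suml.
rewrite [X in _ - X]exchange_big -sumrB; apply: eq_bigr => i _.
rewrite dot_suml.
under [X in _ - X]eq_bigr do rewrite mulr_suml.
rewrite [X in _ - X]exchange_big -sumrB; apply: eq_bigr => j _.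
rewrite dotZl /hess dotDl dotNl dot_sphere_tangent_part// dot_suml mulrBr; congr (_ - _).
by rewrite mulr_sumr; apply: eq_bigr => k _; rewrite dotZl mulrA.
Qed.

Lemma sum_invmx_gram (R : comUnitRingType) (V : lmodType R) (M : 'M[R]_2)
    (T : 'I_2 -> 'I_2 -> V) (E F G D : R) (r t t' w : V) :
  M \in unitmx -> \det M = D ->
  [/\ M 0 0 = E, M 0 1 = F, M 1 0 = F & M 1 1 = G] ->
  T 0 0 = r -> T 0 1 = t -> T 1 0 = t' -> T 1 1 = w ->
  \sum_i \sum_j invmx M i j *: T i j = D^-1 *: (G *: r - F *: (t + t') + E *: w).
Proof.
move=> Mu detM [m00 m01 m10 m11] T00 T01 T10 T11.
by rewrite sum_invmx2// detM m00 m01 m10 m11 T00 T01 T10 T11 (scalerDr F) opprD addrA.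
Qed.

(** * Comparison of the tension field with the derivative along the tangential part of [V0] *)

Theorem theorem1 (R : realType) (J : hyperkahler R) (S : oriented_surface R)
    (g : riemannian_metric S) (X : S -> 'rV[R]_4) (V0 : 'rV[R]_4)
    (phi : S -> 'rV[R]_3) :
  dot V0 V0 = 1 ->
  translating_soliton g X V0 ->
  is_complex_phase_map J g X phi ->
  forall c : chart R S, atlas c -> forall x : 'rV[R]_2, chart_img c x ->
    tension g phi c x = 'D_(tangent_components X c x V0) (phi \o param c) x.
Proof.
move=> _ sol phiP c cA x cx; have [iX _] := sol; have [Fs _] := iX c cA.
set U := chart_img c in Fs cx; have Uopen : open U := @chart_img_open _ _ c.
pose F := X \o param c; pose f := phi \o param c.
pose a : 'rV[R]_2 := delta_mx 0 0; pose b : 'rV[R]_2 := delta_mx 0 1.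
(* [p, q] are [F_1, F_2] and [r, t, w] are [F_11, F_12, F_22]; the existentials make the names
   opaque. *)
have [p pE] : exists p, 'D_a F = p by eexists.
have [q qE] : exists q, 'D_b F = q by eexists.
have [r rE] : exists r, 'D_a p = r by eexists.
have [t tE] : exists t, 'D_b p = t by eexists.
have [w wE] : exists w, 'D_b q = w by eexists.
have ps : smooth_on U p by rewrite -pE; exact: smooth_derive.
have qs : smooth_on U q by rewrite -qE; exact: smooth_derive.
have rs : smooth_on U r by rewrite -rE; exact: smooth_derive.
have ts : smooth_on U t by rewrite -tE; exact: smooth_derive.
have ws : smooth_on U w by rewrite -wE; exact: smooth_derive.
have qaE y : U y -> 'D_a q y = t y.
  by move=> Uy; rewrite -qE -tE -pE; exact: smooth_derive_comm Uopen Fs Uy.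
have near_U (P : 'rV[R]_2 -> Prop) : (forall y, U y -> P y) -> \forall y \near x, P y.
  by move=> UP; apply: filterS (open_nbhs_nbhs (conj Uopen cx)) => y /UP.
(* Symmetry of third derivatives leaves four of them, the [c0, ..., c3] of [phase_map_laplacian]. *)
have tax : 'D_a t x = 'D_b r x by rewrite -tE -rE; exact: smooth_derive_comm Uopen ps cx.
have wax : 'D_a w x = 'D_b t x.
  have e1 : 'D_a w x = 'D_b ('D_a q) x by rewrite -wE; exact: smooth_derive_comm Uopen qs cx.
  have e2 : \forall y \near x, 'D_a q y = t y by exact: near_U qaE.
  have e3 : 'D_b ('D_a q) x = 'D_b t x := near_eq_derive b e2.
  by rewrite e1 e3.
have [pa pb] : (forall y, U y -> is_derive y a p (r y)) /\
    (forall y, U y -> is_derive y b p (t y)).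
  by split=> y Uy; rewrite -?rE -?tE; exact: smooth_is_derive ps Uy.
have qb y : U y -> is_derive y b q (w y) by move=> Uy; rewrite -wE; exact: smooth_is_derive qs Uy.
have qa y : U y -> is_derive y a q (t y).
  by move=> Uy; rewrite -qaE//; exact: smooth_is_derive qs Uy.
have ra := smooth_is_derive a rs cx; have rb := smooth_is_derive b rs cx.
have ta := smooth_is_derive a ts cx; have tb := smooth_is_derive b ts cx.
have wa := smooth_is_derive a ws cx; have wb := smooth_is_derive b ws cx.
rewrite {}tax in ta; rewrite {}wax in wa.
have gdet y : U y -> \det (g c y) = gram (p y) (q y) by move=> Uy; rewrite -pE -qE; exact: immersion_det.
have gpos y : U y -> 0 < dot (p y) (p y) /\ 0 < gram (p y) (q y).
  by move=> Uy; apply: gram_gt0; rewrite -gdet// -unitfE -unitmxE; exact: metric_unitmx.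
have gE y : U y -> [/\ g c y 0 0 = dot (p y) (p y), g c y 0 1 = dot (p y) (q y),
    g c y 1 0 = dot (p y) (q y) & g c y 1 1 = dot (q y) (q y)].
  move=> Uy; rewrite (immersion_metric iX cA Uy).
  rewrite gram_jacobian; last exact: smooth_differentiable Uy.
  by rewrite -pE -qE; split; rewrite mxE; [ | | exact: dotC | ].
have fE y : U y -> f y = (Num.sqrt (gram (p y) (q y)))^-1 *: phase J (p y) (q y).
  by move=> Uy; have := gpos y Uy; rewrite -pE -qE => -[p0 g0]; exact: (complex_phaseE iX phiP cA Uy p0 g0).
have D0 y Uy := (gpos y Uy).2.
pose L y := (gram (p y) (q y))^-1 *: (dot (q y) (q y) *: r y
  - (2 * dot (p y) (q y)) *: t y + dot (p y) (p y) *: w y).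
have LE y : U y -> \sum_i \sum_j invmx (g c y) i j *:
    'D_(delta_mx 0 i) ('D_(delta_mx 0 j) F) y = L y.
  move=> Uy; rewrite /L mulrC mulr_natr mulr2n scalerDl -scalerDr.
  apply: sum_invmx_gram; [exact: metric_unitmx|exact: gdet|exact: gE| | | | ].
  - by rewrite -rE -pE.
  - by rewrite -qaE// -qE.
  - by rewrite -tE -pE.
  - by rewrite -wE -qE.
have JE y (z : 'rV[R]_2) : U y -> z *m 'J F y = z 0 0 *: p y + z 0 1 *: q y.
  move=> Uy; have Fd := smooth_differentiable Fs Uy.
  by rewrite mulmx_sum_row sum2E !row_jacobian// -pE -qE.
have pde y : U y -> exists z, V0 + L y = z *m 'J F y.
  move=> Uy; have /submxP[z] := soliton_span sol cA Uy.
  by rewrite -/F LE// => ->; exists z.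
have pde2 y : U y -> exists z1 z2, V0 + L y = z1 *: p y + z2 *: q y.
  by move=> Uy; have [z ->] := pde y Uy; exists (z 0 0), (z 0 1); rewrite JE.
have [z zE] := pde x cx.
have zVW : z = _ := soliton_components iX cA cx (etrans (congr1 (+%R V0) (LE x cx)) zE).
rewrite JE// in zE.
have f1 y : U y -> dot (f y) (f y) = 1.
  by move=> Uy; have [] := phiP c cA y Uy.
(* The definition of the phase map only constrains its values; derivatives exist thanks to the
   formula [fE]. *)
have fder v : derivable f x v.
  have /near_eq_is_derive := near_U _ (fun y Uy => esym (fE y Uy)).
  have pv := smooth_is_derive v ps cx; have qv := smooth_is_derive v qs cx.
  move/(_ v _ (is_derive_scale (is_derive_invsqrt (is_derive_gram pv qv) (D0 _ cx))
    (is_derive_phase J pv qv))).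
  by case.
have fD v : dot (f x) ('D_v f x) = 0 := sphere_derive_orth Uopen cx f1 (fder v).
set V := tangent_components X c x V0 in zVW *.
(* If the difference [d] of the two sides is nonzero, it can play the role of [mu]; the computation
   then gives [dot d d = 0], a contradiction. *)
apply/eqP; rewrite -subr_eq0; apply: contraT.
have [d dE] : exists d, tension g phi c x - 'D_V f x = d by eexists.
rewrite dE => d0.
have fd : dot (f x) d = 0.
  rewrite -dE dotDr dotNr fD subr0 dotC /tension dot_suml big1// => i _.
  rewrite dot_suml big1// => j _; rewrite dotZl /hess dotDl dotNl dotC.
  rewrite sphere_tangent_part_orth ?f1// dot_suml big1 ?subrr ?mulr0// => k _.
  by rewrite dotZl dotC fD mulr0.
have lap := phase_map_laplacian Uopen cx D0 fE pde2 zE pa pb qa qb ra rb ta tb wa wb d0 fd.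
have Kpq : dot (cplx_comb J d (p x)) (q x) = 0.
  have s0 : (Num.sqrt (gram (p x) (q x)))^-1 != 0 by rewrite invr_eq0 gt_eqF ?sqrtr_gt0 ?D0.
  by apply: (mulfI s0); rewrite mulr0 -fd fE// !dotL dot_phase.
(* So far [f] is known to have directional derivatives, not to depend linearly on the direction.
   This formula transfers linearity from the derivatives of [p] and [q]. *)
have dv v : dot ('D_v f x) d = (Num.sqrt (gram (p x) (q x)))^-1 *
    (dot (cplx_comb J d ('D_v p x)) (q x) + dot (cplx_comb J d (p x)) ('D_v q x)).
  have pv y (Uy : U y) := smooth_is_derive v ps Uy.
  have qv y (Uy : U y) := smooth_is_derive v qs Uy.
  have pvs := smooth_is_derive a (smooth_derive v ps) cx.
  have qvs := smooth_is_derive a (smooth_derive v qs) cx.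
  by have [] := phase_map_jet Uopen cx D0 fE pv qv (pa _ cx) (qa _ cx) pvs qvs Kpq.
have dV : dot ('D_V f x) d = V 0 0 * dot ('D_a f x) d + V 0 1 * dot ('D_b f x) d.
  have dpV : 'D_V p x = V 0 0 *: r x + V 0 1 *: t x.
    by rewrite (derive_sum_delta V (smooth_differentiable ps cx)) sum2E -rE -tE.
  have dqV : 'D_V q x = V 0 0 *: t x + V 0 1 *: w x.
    by rewrite (derive_sum_delta V (smooth_differentiable qs cx)) sum2E -(qaE _ cx) -wE.
  have [rx tx wx] : [/\ 'D_a p x = r x, 'D_b p x = t x & 'D_b q x = w x].
    by rewrite -rE -tE -wE.
  have := dv V; rewrite dpV dqV; have := dv a; rewrite rx (qaE _ cx).
  have := dv b; rewrite tx wx.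
  generalize (dot ('D_a f x) d) (dot ('D_b f x) d) (dot ('D_V f x) d) => ua ub uV -> -> ->.
  rewrite !dotL !cplx_comb_antisym !dotL; clear.
  ring.
(* The second-order part of the tension paired with [d] is the [z]-combination of first derivatives;
   as [z = V + g^ij Gamma_ij], the Christoffel terms cancel and the [V]-terms match [dV]. *)
have dd : dot d d = 0.
  rewrite -{1}dE dotDl dotNl dV tension_dot//.
  have -> : \sum_i \sum_j invmx (g c x) i j *
      dot ('D_(delta_mx 0 i) ('D_(delta_mx 0 j) f) x) d
      = z 0 0 * dot ('D_a f x) d + z 0 1 * dot ('D_b f x) d.
    rewrite -lap.
    (* [R^o] is the field as a module over itself, so the vector-valued lemma applies to scalars. *)
    exact: (@sum_invmx_gram R R^o (g c x)
      (fun i j => dot ('D_(delta_mx 0 i) ('D_(delta_mx 0 j) f) x) d) _ _ _ _ _ _ _ _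
      (metric_unitmx g cA cx) (gdet x cx) (gE x cx) erefl erefl erefl erefl).
  have zk k : z 0 k = V 0 k + \sum_i \sum_j invmx (g c x) i j * christoffel g c x i j k.
    by rewrite {1}zVW !mxE.
  rewrite sum2E !zk -/f -/a -/b.
  generalize (dot ('D_a f x) d) (dot ('D_b f x) d) (V 0 0) (V 0 1) => ua ub v0 v1.
  move: (\sum_i _) (\sum_i _) => W0 W1.
  ring.
by rewrite -dot_eq0 dd eqxx in d0.
Qed.
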